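(* There is an absolute constant $C>0$ such that, for every $k$-armed bandit instance, the Anytime algorithm (which does not know $T$) satisfies, at every sufficiently large round $T$ (i.e. $T\ge T_0(k)$), $$\textsc{NR}_T\le C\sqrt{\frac{k\log T}{T}}\,\log T.$$
   Context: Stochastic multi-armed bandit: $k$ arms, arm $i$ a distribution on $[0,1]$ with mean $\mu_i$, $\mu^*:=\max_i\mu_i$; in round $t$ the algorithm pulls $I_t\in[k]$ and observes an independent reward from arm $I_t$. Nash regret after $T$ rounds: $\textsc{NR}_T:=\mu^*-\big(\prod_{t=1}^T \mathbb{E}[\mu_{I_t}]\big)^{1/T}$. $\log$ is the natural logarithm. Modified NCB algorithm (inputs $k$, window $W$; constant $c=3$): maintain counts $n_i$ and empirical means $\widehat\mu_i$ (both initially $0$), round index $t=1$. Phase 1: while $\max_i n_i\widehat\mu_i\le 420c^2\log W$ and $t\le W$, pull a uniformly random arm, update, increment $t$. Phase 2: while $t\le W$, pull an arm maximizing $\overline{\mathrm{NCB}}_i:=\widehat\mu_i+2c\sqrt{2\widehat\mu_i\log W/n_i}$, update, increment $t$. Anytime algorithm (input $k$): set $W=1$. Repeat (each repetition is an epoch) until the process stops: with probability $1/W^2$, pull uniformly random arms for $W$ rounds; otherwise (probability $1-1/W^2$) execute a fresh run of Modified NCB$(k,W)$ for $W$ rounds; then set $W\leftarrow 2W$. *)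

(* Defs.v *)
From HB Require Import structures.
From mathcomp Require Import all_boot all_order all_algebra.
From mathcomp Require Import all_classical all_reals all_analysis.
Set Implicit Arguments. Unset Strict Implicit. Unset Printing Implicit Defensive.
Import Order.TTheory GRing.Theory Num.Theory.
Local Open Scope ring_scope.
Local Open Scope classical_set_scope.

Section Bandit.
Variable R : realType.
Variable k : nat.
(* Arm i has reward distribution nu i, a probability measure on the Borel sets of R
   (its support is required to lie in [0,1] in the theorem). *)
Variable nu : 'I_k -> probability (measurableTypeR R) R.

Definition arm_mean (i : 'I_k) : R := fine (\int[nu i]_x (x%:E))%E.
Definition mu_star : R := \big[Num.max/0]_(i < k) arm_mean i.

Definition cNCB : R := 3.

(* State of the Anytime algorithm at the beginning of a round (before the
   epoch's coin flip, which happens when tau = 0). *)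
Record state := State {
  W : nat;               (* window of the current epoch *)
  tau : nat;             (* rounds already played in the current epoch *)
  unifmode : bool;       (* true: this epoch is the "uniform for W rounds" branch *)
  phase1 : bool;
  cnt : 'I_k -> nat;
  rsum : 'I_k -> R       (* n_i * hat mu_i = sum of observed rewards of arm i *)
}.

Definition init_state : state := State 1 0 false true (fun _ => 0%N) (fun _ => 0).

Definition reset (s : state) (b : bool) : state :=
  State (W s) 0 b true (fun _ => 0%N) (fun _ => 0).

(* mixture over the coin flip made at the start of each epoch:
   probability 1/W^2 uniform branch, 1 - 1/W^2 fresh Modified NCB run. *)
Definition coin (g : state -> R) (s : state) : R :=
  if tau s == 0%N then
    ((W s)%:R ^- 2) * g (reset s true) + (1 - (W s)%:R ^- 2) * g (reset s false)
  else g s.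

Definition emp_mean (s : state) (i : 'I_k) : R := rsum s i / (cnt s i)%:R.

Definition NCB (s : state) (i : 'I_k) : R :=
  emp_mean s i + 2 * cNCB *
    Num.sqrt (2 * emp_mean s i * ln (W s)%:R / (cnt s i)%:R).

(* Phase 1 condition of Modified NCB: max_i n_i hat mu_i <= 420 c^2 log W
   (and t <= W, which always holds inside the epoch). *)
Definition in_phase1 (s : state) : bool :=
  phase1 s && (\big[Num.max/0]_(i < k) rsum s i <= 420 * cNCB ^+ 2 * ln (W s)%:R).

(* the arm of maximal NCB index (a fixed deterministic tie-breaking rule, via Order.arg_max) *)
Definition ncb_arm (i0 : 'I_k) (s : state) : 'I_k := Order.arg_max i0 xpredT (NCB s).

(* probability of pulling arm i in state s (after the coin flip) *)
Definition policy (i0 : 'I_k) (s : state) (i : 'I_k) : R :=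
  if unifmode s || in_phase1 s then k%:R^-1
  else if i == ncb_arm i0 s then 1 else 0.

Definition update (s : state) (i : 'I_k) (x : R) : state :=
  if (tau s).+1 == W s then
    State (W s * 2) 0 false true (fun _ => 0%N) (fun _ => 0)
  else
    State (W s) (tau s).+1 (unifmode s) (in_phase1 s)
      (fun j => if j == i then (cnt s j).+1 else cnt s j)
      (fun j => if j == i then rsum s j + x else rsum s j).

Definition step_exp (i0 : 'I_k) (g : state -> R) (s : state) : R :=
  coin (fun s' => \sum_(i < k) policy i0 s' i *
                     fine (\int[nu i]_x (g (update s' i x))%:E)%E) s.

Fixpoint iter_exp (i0 : 'I_k) (n : nat) (g : state -> R) (s : state) : R :=
  match n with
  | 0%N => g s
  | n.+1 => step_exp i0 (iter_exp i0 n g) s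
  end.

Definition pulled_mean (i0 : 'I_k) (s : state) : R :=
  coin (fun s' => \sum_(i < k) policy i0 s' i * arm_mean i) s.

(* E[mu_{I_t}] for round t >= 1 *)
Definition exp_pulled_mean (i0 : 'I_k) (t : nat) : R :=
  iter_exp i0 t.-1 (pulled_mean i0) init_state.

Definition nash_regret (i0 : 'I_k) (T : nat) : R :=
  mu_star - powR (\prod_(1 <= t < T.+1) exp_pulled_mean i0 t) (T%:R^-1).

End Bandit.

(* Main.v *)
Require Import Defs.
From HB Require Import structures.
From mathcomp Require Import all_boot all_order all_algebra.
From mathcomp Require Import all_classical all_reals all_analysis.
From mathcomp Require Import measurable_realfun lra ring zify.
Set Implicit Arguments. Unset Strict Implicit. Unset Printing Implicit Defensive.
Import Order.TTheory GRing.Theory Num.Theory.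
Import numFieldNormedType.Exports.
Local Open Scope ring_scope.
Local Open Scope classical_set_scope.

(* The Nash regret is at most (mu / T) * sum_t ln (mu / E[mu_{I_t}]), where mu is
   the largest mean, so it suffices to bound these logarithms epoch by epoch.

   In an epoch of window w the uniform branch alone gives
   E[mu_{I_t}] >= mu / (k w^2), so every round costs at most 3 ln T.  This crude
   bound pays for the small windows and for the first O(k ln w / mu) rounds of
   the other ones.  For later rounds the expected gap mu - E[mu_{I_t}] is at most
   3/5 mu + O(w^-2), hence the logarithm is at most a constant times gap / mu,
   and the gaps are summed in expectation.

   All concentration is by nonnegative supermartingales of the state, evaluated
   along the run:
   - exp(- rsum_star) while phase 1 lasts, which decays geometrically: phase 1
     ends in time;
   - sum_{a,b} exp(rsum_a / 3 - mu cnt_b) in phase 1: when phase 1 ends every arm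
     has been pulled at least 1200 ln w / mu times;
   - exp(l (rsum_i - mean_i cnt_i) - 2 l^2 mu cnt_i), |l| <= 1/2: the empirical
     means deviate by at most 6 sqrt(mu ln w / cnt_i).
   Where none of them is large the NCB index of the best arm is optimistic, and
   the pulled arm I satisfies mu - mean_I <= 18 sqrt(mu ln w / cnt_I), which is
   54 sqrt(mu ln w) times the increment of sum_i sqrt(cnt_i) <= sqrt(k w). *)

(** * Expectations under a law concentrated on the unit interval *)

Section unit_interval_expectation.
Variables (R : realType) (P : probability (measurableTypeR R) R).
Hypothesis P01 : P `[0%R, 1%R] = 1%E.
Implicit Types f g : measurableTypeR R -> R.

(** A bound on the unit interval suffices for integrability, since the rest of the line is null;
    exponential potentials may be unbounded on the whole line. *)
Definition admissible f :=
  measurable_fun setT f /\ exists B, forall x, 0 <= x <= 1 -> `|f x| <= B.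

Let I01 : set (measurableTypeR R) := `[0%R, 1%R].

Let mI01 : measurable I01.
Proof. exact: measurable_itv. Qed.

Let setDI01 : setT `\` ~` I01 = I01.
Proof. by rewrite setTD setCK. Qed.

Let PC0 : P (~` I01) = 0%E.
Proof. by rewrite probability_setC // P01 subee. Qed.

Lemma admissible_integrable01 f : admissible f -> P.-integrable I01 (EFin \o f).
Proof.
move=> [mf [B fB]].
apply: measurable_bounded_integrable => //.
- by apply: (@le_lt_trans _ _ 1%E); [exact: probability_le1|rewrite ltry].
- exact: measurable_funS mf.
- exists B; split; first by rewrite num_real.
  move=> M BM x; rewrite /I01 /= in_itv /= => x01.
  by apply: le_trans (fB _ x01) _; exact: ltW.
Qed.

Lemma admissible_integrable f : admissible f -> P.-integrable setT (EFin \o f).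
Proof.
move=> af; have mC : measurable (~` I01) by exact: measurableC.
apply: (iffRL (negligible_integrable mC measurableT _ PC0)).
  by apply/measurable_EFinP; case: af.
by rewrite setDI01; exact: admissible_integrable01.
Qed.

Lemma expect01 f : admissible f ->
  fine (\int[P]_x (f x)%:E)%E = \int[P]_(x in I01) f x.
Proof.
move=> af; have mC : measurable (~` I01) by exact: measurableC.
rewrite (negligible_integral mC _ (admissible_integrable af) PC0) //.
by rewrite setDI01.
Qed.

Lemma expect_le f g : admissible f -> admissible g ->
  (forall x, 0 <= x <= 1 -> f x <= g x) ->
  fine (\int[P]_x (f x)%:E)%E <= fine (\int[P]_x (g x)%:E)%E.
Proof.
move=> af ag fg; rewrite !expect01 //.
by apply: le_Rintegral => //; exact: admissible_integrable01.
Qed.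

Lemma expect_cst (c : R) : fine (\int[P]_x c%:E)%E = c.
Proof.
transitivity (c * fine (P setT)); first exact: Rintegral_cst.
by rewrite probability_setT mulr1.
Qed.

Lemma expectD f g : admissible f -> admissible g ->
  fine (\int[P]_x (f x + g x)%:E)%E =
  fine (\int[P]_x (f x)%:E)%E + fine (\int[P]_x (g x)%:E)%E.
Proof.
by move=> af ag; apply: RintegralD => //; exact: admissible_integrable.
Qed.

Lemma expectZ (c : R) f : admissible f ->
  fine (\int[P]_x (c * f x)%:E)%E = c * fine (\int[P]_x (f x)%:E)%E.
Proof.
by move=> af; apply: RintegralZl => //; exact: admissible_integrable.
Qed.

Lemma expect_ge0 f : (forall x, 0 <= f x) -> 0 <= fine (\int[P]_x (f x)%:E)%E.
Proof. by move=> f0; apply: Rintegral_ge0. Qed.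

Lemma admissible_cst (c : R) : admissible (cst c).
Proof. by split; [exact: measurable_cst|exists `|c|]. Qed.

Lemma admissible_id : admissible (@id R).
Proof.
split; first exact: measurable_id.
by exists 1 => x /andP[x0 x1]; rewrite ger0_norm.
Qed.

Lemma admissibleD f g : admissible f -> admissible g -> admissible (fun x => f x + g x).
Proof.
move=> [mf [B fB]] [mg [D gD]]; split; first exact: measurable_funD.
exists (B + D) => x x01; apply: le_trans (ler_normD _ _) _.
by rewrite lerD ?fB ?gD.
Qed.

Lemma admissibleZ (c : R) f : admissible f -> admissible (fun x => c * f x).
Proof.
move=> [mf [B fB]]; split; first exact: measurable_funM.
by exists (`|c| * B) => x x01; rewrite normrM ler_wpM2l // fB.
Qed.

Lemma expect_affine (a b : R) :
  fine (\int[P]_x (a + b * x)%:E)%E = a + b * fine (\int[P]_x x%:E)%E.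
Proof.
rewrite (@expectD (cst a) (fun x => b * x)).
- by rewrite expect_cst (@expectZ b id) //; exact: admissible_id.
- exact: admissible_cst.
- by apply: admissibleZ; exact: admissible_id.
Qed.

End unit_interval_expectation.

(** * Measurability of the phase test and of the choice of arm *)

Section measurable_selection.
Context (d : measure_display) (T : measurableType d) (R : realType) (k : nat).

Lemma measurable_all (I : Type) (s : seq I) (b : I -> T -> bool) :
  (forall i, measurable_fun setT (b i)) ->
  measurable_fun setT (fun x => all (b^~ x) s).
Proof.
move=> mb; elim: s => [|i s IH] /=; first exact: measurable_cst.
exact: measurable_and.
Qed.

(** A pick is the head of the filtered enumeration, so induction along the enumeration reduces it to
    nested conditionals. *)
Lemma measurable_pick (I : finType) (i0 : I) (b : I -> T -> bool) (i : I) :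
  (forall j, measurable_fun setT (b j)) ->
  measurable_fun setT (fun x => odflt i0 [pick j | b j x] == i).
Proof.
move=> mb; have -> : (fun x => odflt i0 [pick j | b j x] == i) =
    (fun x => odflt i0 (ohead [seq j <- Finite.enum I | b j x]) == i).
  by apply/funext => x; rewrite /pick /enum_mem; congr (odflt _ (ohead _) == _);
     apply: seq.eq_filter => j; rewrite !inE.
elim: (Finite.enum I) => [|j s IH] /=; first exact: measurable_cst.
have -> : (fun x => odflt i0
    (ohead (if b j x then j :: [seq x0 <- s | b x0 x] else [seq x0 <- s | b x0 x])) == i) =
    (fun x => if b j x then j == i else odflt i0 (ohead [seq x0 <- s | b x0 x]) == i).
  by apply/funext => x; case: (b j x).
by apply: measurable_fun_ifT.
Qed.

Lemma measurable_arg_max (I : finType) (i0 : I) (F : I -> T -> R) (i : I) :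
  (forall j, measurable_fun setT (F j)) ->
  measurable_fun setT (fun x => Order.arg_max i0 xpredT (F^~ x) == i).
Proof.
move=> mF; apply: (@measurable_pick I i0 (fun j x =>
  [forall (j0 | true), F j0 x <= F j x]) i) => j /=.
have -> : (fun x => [forall j0, F j0 x <= F j x]) =
    (fun x => all (fun j0 => F j0 x <= F j x) (enum I)).
  apply/funext => x; apply/forallP/allP => [H j0 _|H j0]; first exact: H.
  by apply: H; rewrite mem_enum.
by apply: measurable_all => j0; exact: measurable_fun_ler.
Qed.

Lemma measurable_sqrt_comp (f : T -> R) : measurable_fun setT f ->
  measurable_fun setT (fun x => Num.sqrt (f x)).
Proof.
move=> mf; apply: (measurableT_comp _ mf); apply: continuous_measurable_fun.
exact: sqrt_continuous.
Qed.

Lemma measurable_expR_comp (f : T -> R) : measurable_fun setT f ->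
  measurable_fun setT (fun x => expR (f x)).
Proof. by move=> mf; apply: (measurableT_comp _ mf); exact: measurable_expR. Qed.

Variables (h : 'I_k -> T -> R) (mh : forall j, measurable_fun setT (h j)).

Lemma measurable_in_phase1 w t u p c :
  measurable_fun setT (fun x => in_phase1 (State w t u p c (h^~ x))).
Proof.
rewrite /in_phase1 /=; apply: measurable_and; first exact: measurable_cst.
pose c0 : R := 420 * cNCB R ^+ 2 * ln w%:R; rewrite -/c0.
(* The maximum starts from the default value 0, hence the separate constraint on [c0]. *)
have -> : (fun x => \big[Num.max/0]_(i < k) h i x <= c0) =
    (fun x => (0 <= c0) && all (fun i => h i x <= c0) (enum 'I_k)).
  apply/funext => x; apply/bigmax_leP/andP => -[c00 H]; split => //.
    by apply/allP => i _; exact: H.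
  by move=> i _; apply: (allP H); rewrite mem_enum.
apply: measurable_and; first exact: measurable_cst.
by apply: measurable_all => i; apply: measurable_fun_ler.
Qed.

Lemma measurable_policy (i0 : 'I_k) w t u p c i :
  measurable_fun setT (fun x => policy i0 (State w t u p c (h^~ x)) i).
Proof.
rewrite /policy /=; apply: measurable_fun_ifT => //.
  apply: measurable_or; first exact: measurable_cst.
  exact: measurable_in_phase1.
apply: measurable_fun_ifT => //.
under eq_fun do rewrite eq_sym.
rewrite /ncb_arm; apply: measurable_arg_max => j.
rewrite /NCB /emp_mean /=; apply: measurable_funD.
  exact: measurable_funM.
apply: measurable_funM => //; apply: measurable_sqrt_comp.
apply: measurable_funM => //; apply: measurable_funM => //.
by apply: measurable_funM => //; apply: measurable_funM.
Qed.

End measurable_selection.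

(** * The one-round operator inside an epoch and the functions it preserves *)

Section play.
Variables (R : realType) (k : nat) (nu : 'I_k -> probability (measurableTypeR R) R).
Hypothesis nu01 : forall i, nu i `[0%R, 1%R] = 1%E.
Variable i0 : 'I_k.
Local Notation state := (state R k).
Local Notation mean := (arm_mean nu).
Implicit Types (s : state) (g : state -> R) (i j : 'I_k).

Lemma mean_itv i : 0 <= mean i <= 1.
Proof.
have aid := @admissible_id R.
apply/andP; split.
  rewrite -[leLHS](@expect_cst R (nu i)); apply: expect_le => //.
    exact: admissible_cst.
  by move=> x /andP[].
rewrite -[leRHS](@expect_cst R (nu i)); apply: expect_le => //.
  exact: admissible_cst.
by move=> x /andP[].
Qed.

Lemma policy_ge0 s i : 0 <= policy i0 s i.
Proof. by rewrite /policy; case: ifP => _; [rewrite invr_ge0|case: ifP]. Qed.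

Lemma sum_policy s : \sum_(i < k) policy i0 s i = 1.
Proof.
have k0 : (0 < k)%N := leq_ltn_trans (leq0n i0) (ltn_ord i0).
rewrite /policy; case: (unifmode s || in_phase1 s).
  by rewrite sumr_const card_ord -[_ *+ k]mulr_natl mulfV // pnatr_eq0 -lt0n.
rewrite (bigD1 (ncb_arm i0 s)) //= eqxx big1 ?addr0 // => i /negbTE ne.
by rewrite ne.
Qed.

(* Unlike [update], [advance] never moves on to the next epoch. *)
Definition advance s i (x : R) : state :=
  State (W s) (tau s).+1 (unifmode s) (in_phase1 s)
    (fun j => if j == i then (cnt s j).+1 else cnt s j)
    (fun j => if j == i then rsum s j + x else rsum s j).

Definition play_step g s : R :=
  \sum_(i < k) policy i0 s i * fine (\int[nu i]_x (g (advance s i x))%:E)%E.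

Definition play n g : state -> R := iter n play_step g.

(** Once the counts are fixed, this confines the reward sums to a bounded box, on which [regular]
    asks for an upper bound. *)
Definition valid s := forall j, 0 <= rsum s j <= (cnt s j)%:R.

Lemma valid_advance s i x : valid s -> 0 <= x <= 1 -> valid (advance s i x).
Proof.
move=> vs /andP[x0 x1] j /=; have /andP[r0 rc] := vs j.
case: ifP => _; last exact: vs.
by rewrite addr_ge0 //= -addn1 natrD lerD.
Qed.

(* Measurability in the reward sums is tested along every measurable
   parametrisation; this makes it stable under the integrals of [play_step]
   without equipping the type of states with a sigma-algebra. *)
Definition regular g :=
  [/\ forall s, 0 <= g s,
      forall (d : measure_display) (T : measurableType d) (h : 'I_k -> T -> R),
        (forall j, measurable_fun setT (h j)) -> forall w t u p c,
        measurable_fun setT (fun x => g (State w t u p c (h^~ x))) &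
      forall w t u p c, exists B, forall r,
        (forall j, 0 <= r j <= (c j)%:R) -> g (State w t u p c r) <= B].

Lemma regular_admissible g s i : regular g -> valid s ->
  admissible (fun x => g (advance s i x)).
Proof.
move=> [g0 mg bg] vs; split.
  apply: (mg _ _ (fun j (x : measurableTypeR R) =>
    if j == i then rsum s j + x else rsum s j)) => j.
  by case: (j == i) => //; apply: measurable_funD => //; exact: measurable_id.
have [B gB] := bg (W s) (tau s).+1 (unifmode s) (in_phase1 s)
  (fun j => if j == i then (cnt s j).+1 else cnt s j).
exists B => x x01; rewrite ger0_norm //; apply: gB => j.
exact: (valid_advance i vs x01).
Qed.

Lemma play_step_ge0 g s : (forall s, 0 <= g s) -> 0 <= play_step g s.
Proof.
move=> g0; apply: sumr_ge0 => i _; rewrite mulr_ge0 ?policy_ge0 //.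
exact: expect_ge0.
Qed.

(** The new reward is adjoined to the parameter space as a second coordinate; regularity of [g]
    gives joint measurability there, and Tonelli integrates the coordinate out. *)
Lemma measurable_play_step g : regular g ->
  forall (d : measure_display) (T : measurableType d) (h : 'I_k -> T -> R),
    (forall j, measurable_fun setT (h j)) -> forall w t u p c,
  measurable_fun setT (fun x => play_step g (State w t u p c (h^~ x))).
Proof.
move=> [g0 mg _] d T h mh w t u p c; rewrite /play_step.
apply: measurable_sum => i; apply: measurable_funM.
  exact: measurable_policy.
pose c' j := if j == i then (c j).+1 else c j.
pose h' j (z : T * measurableTypeR R) := if j == i then h j z.1 + z.2 else h j z.1.
have mh1 j : measurable_fun setT (fun z : T * measurableTypeR R => h j z.1).
  by apply: (measurableT_comp (mh j)); exact: measurable_fst.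
have mh' j : measurable_fun setT (h' j).
  by rewrite /h'; case: (j == i) => //; apply: measurable_funD.
pose f (z : T * measurableTypeR R) : \bar R :=
  (g (advance (State w t u p c (h^~ z.1)) i z.2))%:E.
have f0 z : (0 <= f z)%E by rewrite lee_fin.
have mf : measurable_fun setT f.
  apply/measurable_EFinP.
  (* [regular] fixes the phase flag, whereas the flag after the round depends on the reward sums;
     hence the case split. *)
  have -> : (fun z : T * measurableTypeR R =>
      g (advance (State w t u p c (h^~ z.1)) i z.2)) =
    (fun z => if in_phase1 (State w t u p c (h^~ z.1))
              then g (State w t.+1 u true c' (h'^~ z))
              else g (State w t.+1 u false c' (h'^~ z))).
    by apply/funext => z; rewrite /advance /=; case: (in_phase1 _).
  apply: measurable_fun_ifT; [|exact: mg|exact: mg].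
  exact: (@measurable_in_phase1 _ _ _ _ (fun j (z : T * measurableTypeR R) => h j z.1)).
have := @measurable_fun_fubini_tonelli_F _ _ _ _ R (nu i) f mf f0.
by move=> mF; apply: (measurableT_comp _ mF); exact: fine_measurable.
Qed.

Lemma play_step_le g g' s : regular g -> regular g' -> valid s ->
  (forall i x, 0 <= x <= 1 -> g (advance s i x) <= g' (advance s i x)) ->
  play_step g s <= play_step g' s.
Proof.
move=> rg rg' vs H; apply: ler_sum => i _; rewrite ler_wpM2l ?policy_ge0 //.
apply: expect_le; [exact: nu01|exact: regular_admissible|exact: regular_admissible|].
by move=> x /H.
Qed.

Lemma play_step_le_cst g s (B : R) : regular g -> valid s ->
  (forall i x, 0 <= x <= 1 -> g (advance s i x) <= B) ->
  play_step g s <= B.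
Proof.
move=> rg vs H; rewrite -[leRHS]mul1r -(sum_policy s) mulr_suml.
apply: ler_sum => i _; rewrite ler_wpM2l ?policy_ge0 //.
rewrite -[leRHS](@expect_cst R (nu i)).
apply: expect_le; [exact: nu01|exact: regular_admissible|exact: admissible_cst|].
by move=> x /H.
Qed.

Lemma regular_play_step g : regular g -> regular (play_step g).
Proof.
move=> rg; have [g0 mg bg] := rg; split.
- by move=> s; exact: play_step_ge0.
- exact: measurable_play_step.
- move=> w t u p c.
  (* The bound must serve both values of the phase flag that the next state may carry. *)
  have /choice[B HB] : forall i, exists B, forall b r,
      (forall j, 0 <= r j <= (if j == i then (c j).+1 else c j)%:R) ->
      g (State w t.+1 u b (fun j => if j == i then (c j).+1 else c j) r) <= B.
    move=> i.
    have [B1 H1] := bg w t.+1 u true (fun j => if j == i then (c j).+1 else c j).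
    have [B2 H2] := bg w t.+1 u false (fun j => if j == i then (c j).+1 else c j).
    exists (Num.max B1 B2) => -[] r vr; rewrite le_max.
      by rewrite H1.
    by rewrite H2 ?orbT.
  exists (\sum_i `|B i|) => r vr.
  apply: (play_step_le_cst rg) => // i x x01.
  apply: le_trans (HB i _ _ _) _.
    exact: (@valid_advance (State w t u p c r) i x vr x01).
  rewrite (bigD1 i) //= (le_trans (ler_norm _)) // lerDl.
  by apply: sumr_ge0.
Qed.

Lemma regular_play n g : regular g -> regular (play n g).
Proof. by move=> rg; elim: n => //= n IH; exact: regular_play_step. Qed.

Lemma regular_cst (c : R) : 0 <= c -> regular (fun _ => c).
Proof. by move=> c0; split => // *; exists c. Qed.

Lemma regularD g g' : regular g -> regular g' -> regular (fun s => g s + g' s).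
Proof.
move=> [g0 mg bg] [g0' mg' bg']; split.
- by move=> s; rewrite addr_ge0.
- by move=> d T h mh w t u p c; apply: measurable_funD; [exact: mg|exact: mg'].
- move=> w t u p c; have [B HB] := bg w t u p c; have [D HD] := bg' w t u p c.
  by exists (B + D) => r vr; rewrite lerD ?HB ?HD.
Qed.

Lemma regularZ (c : R) g : 0 <= c -> regular g -> regular (fun s => c * g s).
Proof.
move=> c0 [g0 mg bg]; split.
- by move=> s; rewrite mulr_ge0.
- by move=> d T h mh w t u p q; apply: measurable_funM => //; exact: mg.
- move=> w t u p q; have [B HB] := bg w t u p q.
  by exists (c * B) => r vr; rewrite ler_wpM2l ?HB.
Qed.

Lemma regular_sum (I : Type) (l : seq I) (g : I -> state -> R) :
  (forall a, regular (g a)) -> regular (fun s => \sum_(a <- l) g a s).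
Proof.
move=> rg; elim: l => [|a l IH].
  have -> : (fun s => \sum_(a <- [::]) g a s) = (fun=> 0).
    by apply/funext => s; rewrite big_nil.
  exact: regular_cst.
have -> : (fun s => \sum_(b <- a :: l) g b s) = (fun s => g a s + \sum_(b <- l) g b s).
  by apply/funext => s; rewrite big_cons.
exact: regularD.
Qed.

Lemma regular_if_phase1 g g' : regular g -> regular g' ->
  regular (fun s => if phase1 s then g s else g' s).
Proof.
move=> [g0 mg bg] [g0' mg' bg']; split.
- by move=> s; case: ifP.
- by move=> d T h mh w t u [] c; [exact: mg|exact: mg'].
- by move=> w t u [] c; [exact: bg|exact: bg'].
Qed.

Lemma regular_cnt (F : ('I_k -> nat) -> R) : (forall c, 0 <= F c) ->
  regular (fun s => F (cnt s)).
Proof. by move=> F0; split => //= w t u p c; exists (F c). Qed.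

Lemma regular_expR (a : 'I_k) (l : R) (F : ('I_k -> nat) -> R) :
  regular (fun s => expR (l * rsum s a + F (cnt s))).
Proof.
split => [s|d T h mh w t u p c|w t u p c /=]; first exact: expR_ge0.
  apply: measurable_expR_comp; apply: measurable_funD => //=.
  exact: measurable_funM.
exists (expR (`|l| * (c a)%:R + F c)) => r vr; rewrite ler_expR lerD2r.
have /andP[r0 rc] := vr a; apply: le_trans (ler_norm _) _.
by rewrite normrM (ger0_norm r0) ler_wpM2l.
Qed.

Definition policy_mean s : R := \sum_(i < k) policy i0 s i * mean i.

Lemma regular_policy_mean : regular policy_mean.
Proof.
split => [s|d T h mh w t u p c|w t u p c /=].
- apply: sumr_ge0 => i _; rewrite mulr_ge0 ?policy_ge0 //.
  by have /andP[] := mean_itv i.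
- apply: measurable_sum => i; apply: measurable_funM => //.
  exact: measurable_policy.
- exists 1 => r _; rewrite -(sum_policy (State w t u p c r)).
  apply: ler_sum => i _; rewrite ler_piMr ?policy_ge0 //.
  by have /andP[] := mean_itv i.
Qed.

Lemma play_stepD g g' s : regular g -> regular g' -> valid s ->
  play_step (fun s => g s + g' s) s = play_step g s + play_step g' s.
Proof.
move=> rg rg' vs; rewrite /play_step -big_split /=; apply: eq_bigr => i _.
by rewrite -mulrDr -expectD //; exact: regular_admissible.
Qed.

Lemma play_stepZ (c : R) g s : regular g -> valid s ->
  play_step (fun s => c * g s) s = c * play_step g s.
Proof.
move=> rg vs; rewrite /play_step mulr_sumr; apply: eq_bigr => i _.
rewrite mulrCA; congr (_ * _).
by apply: expectZ; [exact: nu01|exact: regular_admissible].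
Qed.

Lemma play_step_cst (c : R) g s : (forall i x, g (advance s i x) = c) ->
  play_step g s = c.
Proof.
move=> H; rewrite -[RHS]mul1r -(sum_policy s) mulr_suml; apply: eq_bigr => i _.
congr (_ * _); rewrite -[RHS](@expect_cst R (nu i)).
by congr fine; apply: eq_integral => x _; rewrite H.
Qed.

End play.

(** * Reduction of the Anytime algorithm to runs inside a single epoch *)

Section epochs.
Variables (R : realType) (k : nat) (nu : 'I_k -> probability (measurableTypeR R) R).
Variable i0 : 'I_k.
Local Notation state := (state R k).
Local Notation mean := (arm_mean nu).
Implicit Types (s : state) (g : state -> R) (i j : 'I_k).

Definition fresh w b : state := State w 0 b true (fun=> 0%N) (fun=> 0).

Lemma iter_exp_add m n g : iter_exp nu i0 (m + n) g = iter_exp nu i0 m (iter_exp nu i0 n g).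
Proof. by elim: m => //= m IH; rewrite IH. Qed.

Lemma step_exp_cst (c : R) g s :
  (forall s' i x, W s' = W s -> tau s' = tau s -> g (update s' i x) = c) ->
  step_exp nu i0 g s = c.
Proof.
move=> H; have H' s' : W s' = W s -> tau s' = tau s ->
    \sum_(i < k) policy i0 s' i * fine (\int[nu i]_x (g (update s' i x))%:E)%E = c.
  move=> Ws ts; rewrite -[RHS]mul1r -(sum_policy i0 s') mulr_suml.
  apply: eq_bigr => i _; congr (_ * _); rewrite -[RHS](@expect_cst R (nu i)).
  by congr fine; apply: eq_integral => x _; rewrite H.
rewrite /step_exp /coin; case: ifP => [/eqP t0|_]; last exact: H'.
by rewrite !H' //; ring.
Qed.

Lemma update_advance s i x : (tau s).+1 != W s -> update s i x = advance s i x.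
Proof. by rewrite /update /advance => /negbTE ->. Qed.

(** The last update of a window discards all statistics, so the state reached does not depend on the
    coin, the arms or the rewards. *)
Lemma iter_exp_epoch_end n g s : (tau s + n.+1)%N = W s ->
  iter_exp nu i0 n.+1 g s = g (fresh (W s * 2) false).
Proof.
elim: n s => [|n IH] s Hs.
  apply: step_exp_cst => s' i x Ws ts /=.
  by rewrite /update Ws ts -Hs addn1 eqxx.
apply: step_exp_cst => s' i x Ws ts.
have ne : (tau s').+1 != W s' by rewrite Ws ts -Hs; apply/eqP; lia.
rewrite (update_advance _ _ ne) -Ws; apply: (IH (advance s' i x)).
by rewrite /= Ws ts -Hs; lia.
Qed.

(** The earlier epochs last 1 + 2 + ... + 2^(e-1) = 2^e - 1 rounds, and each hands a blank state to
    the next. *)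
Lemma iter_exp_init e g :
  iter_exp nu i0 (2 ^ e).-1 g (init_state R k) = g (fresh (2 ^ e) false).
Proof.
elim: e g => [|e IH] g //=.
have e0 : (0 < 2 ^ e)%N by rewrite expn_gt0.
have -> : (2 ^ e.+1).-1 = ((2 ^ e).-1 + (2 ^ e).-1.+1)%N by rewrite expnS; lia.
rewrite iter_exp_add IH iter_exp_epoch_end /= ?prednK // expnS.
by rewrite mulnC.
Qed.

(** Strictly inside an epoch no coin is flipped and the window does not close, so [update] agrees
    with [advance]. *)
Lemma iter_exp_play n s : (0 < tau s)%N -> (tau s + n < W s)%N ->
  iter_exp nu i0 n (pulled_mean nu i0) s = play nu i0 n (policy_mean nu i0) s.
Proof.
elim: n s => [|n IH] s t0 tW /=.
  by rewrite /pulled_mean /coin eqn0Ngt t0.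
rewrite /step_exp /coin eqn0Ngt t0 /=; apply: eq_bigr => i _; congr (_ * fine _).
apply: eq_integral => x _; congr EFin.
rewrite update_advance; last by apply/eqP; lia.
by rewrite IH //=; lia.
Qed.

Lemma iter_exp_fresh w (j : nat) b : (j < w)%N ->
  iter_exp nu i0 j (pulled_mean nu i0) (fresh w b) =
  w%:R ^- 2 * play nu i0 j (policy_mean nu i0) (fresh w true) +
  (1 - w%:R ^- 2) * play nu i0 j (policy_mean nu i0) (fresh w false).
Proof.
case: j => [|j] jw //=.
have H s' : W s' = w -> tau s' = 0%N ->
    \sum_(i < k) policy i0 s' i * fine (\int[nu i]_x
       (iter_exp nu i0 j (pulled_mean nu i0) (update s' i x))%:E)%E =
    play_step nu i0 (play nu i0 j (policy_mean nu i0)) s'.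
  move=> Ws ts; apply: eq_bigr => i _; congr (_ * fine _).
  apply: eq_integral => x _; congr EFin.
  rewrite update_advance ?Ws ?ts; last by apply/eqP; lia.
  by rewrite iter_exp_play //= ?Ws ts; lia.
by rewrite /step_exp /coin /= !H.
Qed.

Lemma policy_mean_unif s : unifmode s ->
  policy_mean nu i0 s = k%:R^-1 * \sum_(i < k) mean i.
Proof.
by move=> us; rewrite mulr_sumr; apply: eq_bigr => i _; rewrite /policy us.
Qed.

Lemma play_unif n s : unifmode s ->
  play nu i0 n (policy_mean nu i0) s = k%:R^-1 * \sum_(i < k) mean i.
Proof.
elim: n s => [|n IH] s us; first exact: policy_mean_unif.
by apply: play_step_cst => i x; exact: IH.
Qed.

Lemma exp_pulled_meanE e (j : nat) : (j < 2 ^ e)%N ->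
  exp_pulled_mean nu i0 (2 ^ e + j) =
  (2 ^ e)%:R ^- 2 * (k%:R^-1 * \sum_(i < k) mean i) +
  (1 - (2 ^ e)%:R ^- 2) *
    play nu i0 j (policy_mean nu i0) (fresh (2 ^ e) false).
Proof.
move=> je; rewrite /exp_pulled_mean.
have e0 : (0 < 2 ^ e)%N by rewrite expn_gt0.
(* A round is preceded by one fewer iteration: 2^e - 1 to reach this epoch, then [j] inside it. *)
have -> : (2 ^ e + j).-1 = ((2 ^ e).-1 + j)%N by lia.
by rewrite iter_exp_add iter_exp_init iter_exp_fresh // (play_unif j (s := fresh _ true)).
Qed.

End epochs.

(** * Linearity, monotonicity and supermartingale bounds for [play] *)

Section play_theory.
Variables (R : realType) (k : nat) (nu : 'I_k -> probability (measurableTypeR R) R).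
Hypothesis nu01 : forall i, nu i `[0%R, 1%R] = 1%E.
Variables (i0 : 'I_k) (w : nat).
Local Notation state := (state R k).
Local Notation mean := (arm_mean nu).
Local Notation play_step := (play_step nu i0).
Local Notation play := (play nu i0).
Implicit Types (s : state) (g : state -> R) (i j : 'I_k).

(** Invariants of a Modified NCB run after [t] rounds. The total count is what later limits the sum
    of the square roots of the counts. *)
Definition reachable t s :=
  [/\ W s = w, tau s = t, unifmode s = false, valid s &
      (\sum_(i < k) cnt s i)%N = t].

Lemma reachable_fresh : reachable 0 (fresh R k w false).
Proof.
split => //=; last by rewrite big1.
by move=> j /=; rewrite lexx.
Qed.

Lemma reachable_valid t s : reachable t s -> valid s.
Proof. by case. Qed.

Lemma reachable_advance t s i x : reachable t s -> 0 <= x <= 1 ->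
  reachable t.+1 (advance s i x).
Proof.
move=> [Ws ts us vs cs] x01; split => //=; [by rewrite ts|exact: valid_advance|].
rewrite -cs (bigD1 i) //= [in RHS](bigD1 i) //= eqxx addSn; congr (_ + _).+1.
by apply: eq_bigr => j /negbTE ->.
Qed.

Lemma reachable_cnt_le t s i : reachable t s -> (cnt s i <= t)%N.
Proof. by case=> _ _ _ _ <-; rewrite (bigD1 i) //= leq_addr. Qed.

Lemma play_le n g g' t s : regular g -> regular g' -> reachable t s ->
  (forall s', reachable (t + n) s' -> g s' <= g' s') -> play n g s <= play n g' s.
Proof.
move=> rg rg'; elim: n t s => [|n IH] t s Hs H /=.
  by apply: H; rewrite addn0.
apply: play_step_le => //; try exact: regular_play.
  exact: reachable_valid Hs.
move=> i x x01; apply: (IH t.+1); first exact: reachable_advance.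
by move=> s' Hs'; apply: H; rewrite addnS -addSn.
Qed.

Lemma play_step_eq g g' s : regular g -> regular g' -> valid s ->
  (forall i x, 0 <= x <= 1 -> g (advance s i x) = g' (advance s i x)) ->
  play_step g s = play_step g' s.
Proof.
move=> rg rg' vs H; apply/eqP; rewrite eq_le; apply/andP.
by split; apply: play_step_le => // i x /(H i) ->.
Qed.

Lemma playD n g g' t s : regular g -> regular g' -> reachable t s ->
  play n (fun s => g s + g' s) s = play n g s + play n g' s.
Proof.
move=> rg rg'; elim: n t s => //= n IH t s Hs.
rewrite -play_stepD //; try exact: regular_play; last exact: reachable_valid Hs.
apply: play_step_eq; try exact: reachable_valid Hs.
- exact/regular_play/regularD.
- by apply: regularD; exact: regular_play.
- by move=> i x x01; apply: (IH t.+1); exact: reachable_advance.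
Qed.

Lemma playZ n (c : R) g t s : 0 <= c -> regular g -> reachable t s ->
  play n (fun s => c * g s) s = c * play n g s.
Proof.
move=> c0 rg; elim: n t s => //= n IH t s Hs.
rewrite -play_stepZ //; try exact: regular_play; last exact: reachable_valid Hs.
apply: play_step_eq; try exact: reachable_valid Hs.
- exact/regular_play/regularZ.
- by apply: regularZ => //; exact: regular_play.
- by move=> i x x01; apply: (IH t.+1); exact: reachable_advance.
Qed.

Lemma play_cst n (c : R) s : play n (fun=> c) s = c.
Proof. by elim: n s => //= n IH s; apply: play_step_cst => i x; exact: IH. Qed.

Lemma play_ge0 n g s : (forall s, 0 <= g s) -> 0 <= play n g s.
Proof. by move=> g0; elim: n s => //= n IH s; exact: play_step_ge0. Qed.

Lemma play_step_sum (I : Type) (l : seq I) (g : I -> state -> R) s :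
  (forall a, regular (g a)) -> valid s ->
  play_step (fun s => \sum_(a <- l) g a s) s = \sum_(a <- l) play_step (g a) s.
Proof.
move=> rg vs; elim: l => [|a l IH].
  by rewrite big_nil; apply: play_step_cst => i x; rewrite big_nil.
rewrite big_cons -IH -play_stepD //; last exact: regular_sum.
apply: play_step_eq => //; first exact: regular_sum.
  by apply: regularD => //; exact: regular_sum.
by move=> i x _; rewrite big_cons.
Qed.

Lemma play_geom n (rho : R) g t s : 0 <= rho -> regular g -> reachable t s ->
  (forall t' s', reachable t' s' -> play_step g s' <= rho * g s') ->
  play n g s <= rho ^+ n * g s.
Proof.
move=> rho0 rg; elim: n t s => [|n IH] t s Hs H /=; first by rewrite expr0 mul1r.
have vs := reachable_valid Hs.
apply: (@le_trans _ _ (play_step (fun s => rho ^+ n * g s) s)).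
  apply: play_step_le => //; first exact: regular_play.
    by apply: regularZ => //; rewrite exprn_ge0.
  by move=> i x x01; apply: (IH t.+1) => //; exact: reachable_advance.
rewrite play_stepZ // exprSr -mulrA ler_wpM2l ?exprn_ge0 //.
exact: H Hs.
Qed.

Lemma play_supermartingale n g t s : regular g -> reachable t s ->
  (forall t' s', reachable t' s' -> play_step g s' <= g s') -> play n g s <= g s.
Proof.
move=> rg Hs H; have := @play_geom n 1 g t s ler01 rg Hs.
rewrite expr1n mul1r; apply => t' s' Hs'; rewrite mul1r; exact: H Hs'.
Qed.

(** An affine majorant on the unit interval turns an expectation into an expression in the mean
    alone; all exponential potentials are bounded this way. *)
Lemma expect_le_affine g s i (a b : R) : regular g -> valid s ->
  (forall x, 0 <= x <= 1 -> g (advance s i x) <= a + b * x) ->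
  fine (\int[nu i]_x (g (advance s i x))%:E)%E <= a + b * mean i.
Proof.
move=> rg vs H; rewrite -[leRHS](@expect_affine R (nu i)) //.
apply: expect_le => //; first exact: regular_admissible.
by apply: admissibleD; [exact: admissible_cst|apply: admissibleZ; exact: admissible_id].
Qed.

Lemma play_step_le_arm g s (B : R) :
  (forall i, fine (\int[nu i]_x (g (advance s i x))%:E)%E <= B) -> play_step g s <= B.
Proof.
move=> H; rewrite -[leRHS]mul1r -(sum_policy i0 s) mulr_suml.
by apply: ler_sum => i _; rewrite ler_wpM2l ?policy_ge0.
Qed.

(** The policy is uniform in phase 1, so a cost attached to a single arm enters with weight 1/k. *)
Lemma play_step_le_unif g s (A : R) (c : 'I_k -> R) : in_phase1 s ->
  (forall i, fine (\int[nu i]_x (g (advance s i x))%:E)%E <= A + c i) ->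
  play_step g s <= A + k%:R^-1 * \sum_(i < k) c i.
Proof.
move=> ps H; apply: (@le_trans _ _ (\sum_(i < k) policy i0 s i * (A + c i))).
  by apply: ler_sum => i _; rewrite ler_wpM2l ?policy_ge0.
under eq_bigr do rewrite mulrDr.
rewrite big_split /= -mulr_suml sum_policy mul1r lerD2l mulr_sumr.
by apply: ler_sum => i _; rewrite /policy ps orbT.
Qed.

End play_theory.

(** * Elementary polynomial bounds on the exponential *)

Section expR_bounds.
Variable R : realType.
Implicit Types x y : R.

(** Comes from 1 - y <= exp(-y). Multiplying by this factor reduces each bound below to a polynomial
    inequality. *)
Let expR_mul_le1 y : expR y * (1 - y) <= 1.
Proof.
rewrite -[leRHS](@expR0 R) -(subrr y) expRD ler_wpM2l ?expR_ge0 //.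
exact: expR_ge1Dx.
Qed.

Lemma expR_le_quadratic y : y <= 1 / 2 -> expR y <= 1 + y + 2 * y ^+ 2.
Proof.
move=> y2; have y1 : 0 < 1 - y by lra.
rewrite -(ler_pM2r y1); apply: le_trans (expR_mul_le1 y) _.
suff : 0 <= y ^+ 2 * (1 - 2 * y) by lra.
by rewrite mulr_ge0 ?sqr_ge0 //; lra.
Qed.

Lemma expRN_le_half x : 0 <= x <= 1 -> expR (- x) <= 1 - x / 2.
Proof.
move=> /andP[x0 x1]; have y1 : 0 < 1 - - x by lra.
rewrite -(ler_pM2r y1); apply: le_trans (expR_mul_le1 _) _.
suff : 0 <= x * (1 - x) by lra.
by rewrite mulr_ge0 //; lra.
Qed.

Lemma expR_third_le_half x : 0 <= x <= 1 -> expR (x / 3) <= 1 + x / 2.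
Proof.
move=> /andP[x0 x1]; have y1 : 0 < 1 - x / 3 by lra.
rewrite -(ler_pM2r y1); apply: le_trans (expR_mul_le1 _) _.
suff : 0 <= x * (1 - x) by lra.
by rewrite mulr_ge0 //; lra.
Qed.

Lemma sum_indicator (k : nat) (a : 'I_k) (c : R) : \sum_(i < k) (i == a)%:R * c = c.
Proof.
rewrite (bigD1 a) //= eqxx mul1r big1 ?addr0 // => i /negbTE ->.
by rewrite mul0r.
Qed.

End expR_bounds.

(** * The supermartingales controlling phase 1 and the empirical means *)

Section potentials.
Variables (R : realType) (k : nat) (nu : 'I_k -> probability (measurableTypeR R) R).
Hypothesis nu01 : forall i, nu i `[0%R, 1%R] = 1%E.
Variables (i0 : 'I_k) (w : nat) (star : 'I_k).
Local Notation state := (state R k).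
Local Notation mean := (arm_mean nu).
Local Notation play_step := (play_step nu i0).
Local Notation play := (play nu i0).
Local Notation reachable := (@reachable R k w).
Implicit Types (s : state) (g : state -> R) (i j : 'I_k).
Let mu : R := mean star.
Hypothesis mean_le : forall i, mean i <= mu.
Let L : R := ln w%:R.
Hypothesis L0 : 0 <= L.

Let mu01 : 0 <= mu <= 1.
Proof. exact: mean_itv. Qed.

Let k1 : 1 <= k%:R :> R.
Proof. by rewrite ler1n; exact: leq_ltn_trans (leq0n i0) (ltn_ord i0). Qed.

(** The stored flag is tested rather than [in_phase1], so the potential vanishes one round after the
    threshold is crossed. *)
Definition pot_still1 s : R := if phase1 s then expR (- rsum s star) else 0.

Lemma regular_still1 : regular pot_still1.
Proof.
apply: regular_if_phase1; last exact: regular_cst.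
have -> : (fun s => expR (- rsum s star)) =
    (fun s => expR (-1 * rsum s star + 0)).
  by apply/funext => s; rewrite mulN1r addr0.
exact: (@regular_expR R k star (-1) (fun=> 0)).
Qed.

(** The best arm is pulled with probability 1/k, and such a pull multiplies the potential by at most
    1 - mu/2 on average. *)
Lemma step_still1 t s : reachable t s ->
  play_step pot_still1 s <= (1 - mu / (2 * k%:R)) * pot_still1 s.
Proof.
move=> Hs; have vs := reachable_valid Hs; have /andP[mu0 mu1] := mu01.
have k1' := k1.
case: (boolP (in_phase1 s)) => ps; last first.
  have -> : play_step pot_still1 s = 0.
    by apply: play_step_cst => i x; rewrite /pot_still1 /= (negbTE ps).
  rewrite mulr_ge0 ?subr_ge0 //; last by rewrite /pot_still1; case: ifP; rewrite ?expR_ge0.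
  by rewrite ler_pdivrMr; lra.
have p1 : phase1 s by case/andP: ps.
pose A := expR (- rsum s star).
have -> : pot_still1 s = A by rewrite /pot_still1 p1.
have A0 : 0 <= A by exact: expR_ge0.
have -> : (1 - mu / (2 * k%:R)) * A =
    A + k%:R^-1 * \sum_(i < k) (i == star)%:R * (- (A * mu / 2)).
  rewrite sum_indicator; field; lra.
apply: play_step_le_unif => // i.
have -> : A + (i == star)%:R * (- (A * mu / 2)) =
    A + (i == star)%:R * (- (A / 2)) * mean i.
  by case: eqP => [->|_]; rewrite /mu ?mul0r //=; field.
apply: expect_le_affine => //; first exact: regular_still1.
move=> x x01; rewrite /pot_still1 /= ps [star == i]eq_sym; case: eqP => _.
  rewrite opprD expRD -/A; have := expRN_le_half x01.
  by move=> /(ler_wpM2l A0); rewrite [true%:R * _]mul1r; lra.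
by rewrite -/A mul0r mul0r addr0.
Qed.

Definition threshold : R := 420 * cNCB R ^+ 2 * L.

(* The bound on [mu * cnt] which the end of phase 1 certifies for every arm. *)
Definition enough : R := 1200 * L.

Definition pot_short_pair (a b : 'I_k) s : R :=
  expR (rsum s a / 3 - mu * (cnt s b)%:R).

(** After phase 1 the double sum gives way to a charge for each under-sampled arm. The exchange is
    no increase because some reward sum then exceeds [threshold], and the charge can only decrease
    as counts grow. *)
Definition pot_short s : R :=
  if phase1 s then \sum_(a < k) \sum_(b < k) pot_short_pair a b s
  else \sum_(b < k) (mu * (cnt s b)%:R < enough)%R%:R * expR (threshold / 3 - enough).

Lemma regular_short_pair a b : regular (pot_short_pair a b).
Proof.
have -> : pot_short_pair a b =
    (fun s => expR (3^-1 * rsum s a - mu * (cnt s b)%:R)).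
  by apply/funext => s; rewrite /pot_short_pair [_ / 3]mulrC.
exact: (@regular_expR R k a 3^-1 (fun c => - (mu * (c b)%:R))).
Qed.

Lemma regular_short : regular pot_short.
Proof.
apply: regular_if_phase1.
  by apply: regular_sum => a; apply: regular_sum => b; exact: regular_short_pair.
apply: (regular_cnt (F := fun c => \sum_(b < k) (mu * (c b)%:R < enough)%R%:R *
  expR (threshold / 3 - enough))) => c.
by apply: sumr_ge0 => b _; rewrite mulr_ge0 ?expR_ge0.
Qed.

(* A pull of [a] multiplies the potential by at most [1 + mu/2] on average, a
   pull of [b] by at most [1 - mu/2], and both are equally likely. *)
Lemma step_short_pair a b t s : reachable t s -> in_phase1 s ->
  play_step (pot_short_pair a b) s <= pot_short_pair a b s.
Proof.
move=> Hs ps; have vs := reachable_valid Hs; have /andP[mu0 mu1] := mu01.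
set A := pot_short_pair a b s; have A0 : 0 <= A by exact: expR_ge0.
have -> : A = A + k%:R^-1 * \sum_(i < k) ((i == a)%:R * (A * mu / 2) +
    (i == b)%:R * (- (A * mu / 2))).
  by rewrite big_split /= !sum_indicator subrr mulr0 addr0.
apply: play_step_le_unif => // i.
set ca : R := (i == a)%:R; set cb : R := (i == b)%:R.
have ca0 : 0 <= ca <= 1 by rewrite /ca ler0n lern1 leq_b1.
have cb0 : 0 <= cb <= 1 by rewrite /cb ler0n lern1 leq_b1.
have D0 : 0 <= A * (1 - cb * mu / 2).
  by rewrite mulr_ge0 // subr_ge0; nra.
apply: (@le_trans _ _ (A * (1 - cb * mu / 2) + (A * (1 - cb * mu / 2)) * ca / 2 * mean i)).
  apply: expect_le_affine => //; first exact: regular_short_pair.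
  move=> x x01.
  have -> : pot_short_pair a b (advance s i x) = A * expR (- (cb * mu)) * expR (ca * x / 3).
    rewrite /pot_short_pair /= -!expRD /ca /cb [a == i]eq_sym [b == i]eq_sym.
    by congr expR; case: (i == a); case: (i == b); rewrite /= ?mul0r ?mul1r -?natr1; field.
  have e1 : expR (- (cb * mu)) <= 1 - cb * mu / 2.
    by apply: expRN_le_half; rewrite /cb; case: (i == b); rewrite ?mul1r ?mul0r //; lra.
  have e2 : expR (ca * x / 3) <= 1 + ca * x / 2.
    by apply: expR_third_le_half; rewrite /ca; case: (i == a); rewrite ?mul1r ?mul0r //; lra.
  have -> : A * (1 - cb * mu / 2) + A * (1 - cb * mu / 2) * ca / 2 * x =
      A * (1 - cb * mu / 2) * (1 + ca * x / 2) by field.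
  apply: ler_pM; rewrite ?expR_ge0 ?mulr_ge0 ?expR_ge0 //.
  by rewrite ler_wpM2l.
have -> : A + (ca * (A * mu / 2) + cb * - (A * mu / 2)) =
   A * (1 + ca * mu / 2 - cb * mu / 2) by field.
have -> : A * (1 - cb * mu / 2) + A * (1 - cb * mu / 2) * ca / 2 * mean i =
   A * ((1 - cb * mu / 2) * (1 + ca * mean i / 2)) by field.
rewrite ler_wpM2l //.
have /andP[m0 _] := mean_itv nu01 i.
have h1 : (1 - cb * mu / 2) * (1 + ca * mean i / 2) <=
          (1 - cb * mu / 2) * (1 + ca * mu / 2).
  rewrite ler_wpM2l //; first by nra.
  have := mean_le i; case/andP: ca0 => ca0 _ => /(ler_wpM2l ca0); lra.
apply: le_trans h1 _.
(* The cross term of the product is nonpositive; it is nonzero only if [a] and [b] are both the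
   pulled arm. *)
suff : 0 <= (cb * mu) * (ca * mu) by lra.
by case/andP: ca0 => ? _; case/andP: cb0 => ? _; rewrite !mulr_ge0.
Qed.

Lemma threshold_ge0 : 0 <= threshold.
Proof. by rewrite /threshold /cNCB !mulr_ge0 ?exprn_ge0 ?ler0n. Qed.

Lemma not_in_phase1 s : W s = w -> phase1 s -> ~~ in_phase1 s ->
  exists a, threshold < rsum s a.
Proof.
move=> Ws p1; rewrite /in_phase1 p1 Ws /= => /negP H; apply: contrapT => /forallNP H'.
apply: H; apply/bigmax_leP; split; first exact: threshold_ge0.
by move=> i _; rewrite leNgt; apply/negP; exact: H'.
Qed.

(** If phase 1 has just ended, the arm above [threshold], paired with an under-sampled [b],
    contributes at least the charge of [b]; later both sides coincide. *)
Lemma short_certificate t s : reachable t s -> ~~ in_phase1 s ->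
  \sum_(b < k) (mu * (cnt s b)%:R < enough)%R%:R * expR (threshold / 3 - enough) <=
  pot_short s.
Proof.
move=> [Ws _ _ _ _] ps; rewrite /pot_short; case: ifP => // p1.
have [a Ha] := not_in_phase1 Ws p1 ps.
rewrite [leRHS](bigD1 a) //=; apply: ler_wpDr.
  by apply: sumr_ge0 => a' _; apply: sumr_ge0 => b _; exact: expR_ge0.
apply: ler_sum => b _; case: ltP => Hb; last by rewrite mul0r expR_ge0.
by rewrite mul1r ler_expR; lra.
Qed.

Lemma step_short t s : reachable t s -> play_step pot_short s <= pot_short s.
Proof.
move=> Hs; have vs := reachable_valid Hs; have /andP[mu0 mu1] := mu01.
case: (boolP (in_phase1 s)) => ps.
  rewrite {2}/pot_short; have -> : phase1 s by case/andP: ps.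
  have rin a : regular (fun s => \sum_(b < k) pot_short_pair a b s).
    by apply: regular_sum => b; exact: regular_short_pair.
  have -> : play_step pot_short s =
      play_step (fun s => \sum_(a < k) \sum_(b < k) pot_short_pair a b s) s.
    apply: play_step_eq => //; [exact: regular_short|exact: regular_sum|].
    by move=> i x x01; rewrite /pot_short /= ps.
  rewrite play_step_sum //; apply: ler_sum => a _.
  rewrite play_step_sum //; last by move=> b; exact: regular_short_pair.
  by apply: ler_sum => b _; exact: step_short_pair Hs ps.
apply: le_trans (short_certificate Hs ps).
apply: (play_step_le_cst nu01) => //; first exact: regular_short.
move=> i x x01; rewrite /pot_short /= (negbTE ps).
apply: ler_sum => b _; rewrite ler_wpM2r ?expR_ge0 // ler_nat.
case: ltP => // H; suff -> : mu * (cnt s b)%:R < enough by [].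
apply: le_lt_trans H; rewrite ler_wpM2l // ler_nat; case: (b == i) => //.
Qed.

(** Chernoff supermartingale with variance proxy proportional to [mu]: a reward in the unit interval
    has second moment at most its mean. This is why deviations scale with sqrt(mu). *)
Definition pot_dev i (l : R) s : R :=
  expR (l * (rsum s i - mean i * (cnt s i)%:R) - 2 * l ^+ 2 * mu * (cnt s i)%:R).

Lemma regular_dev i l : regular (pot_dev i l).
Proof.
have -> : pot_dev i l = (fun s => expR (l * rsum s i +
    (- (l * mean i * (cnt s i)%:R) - 2 * l ^+ 2 * mu * (cnt s i)%:R))).
  by apply/funext => s; congr expR; ring.
exact: (@regular_expR R k i l
  (fun c => - (l * mean i * (c i)%:R) - 2 * l ^+ 2 * mu * (c i)%:R)).
Qed.

Lemma step_dev i l t s : `|l| <= 1 / 2 -> reachable t s ->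
  play_step (pot_dev i l) s <= pot_dev i l s.
Proof.
move=> l2 Hs; have vs := reachable_valid Hs; have /andP[mu0 mu1] := mu01.
set A := pot_dev i l s; have A0 : 0 <= A by exact: expR_ge0.
apply: play_step_le_arm => j; case: (eqVneq j i) => [->|ne]; last first.
  rewrite -[leRHS](@expect_cst R (nu j)) le_eqVlt; apply/orP; left; apply/eqP.
  congr fine; apply: eq_integral => x _; congr EFin.
  by rewrite /A /pot_dev /= eq_sym (negbTE ne).
set c0 := expR (- (l * mean i) - 2 * l ^+ 2 * mu).
have c00 : 0 <= c0 by exact: expR_ge0.
apply: (@le_trans _ _ (A * c0 + A * c0 * (l + 2 * l ^+ 2) * mean i)).
  apply: expect_le_affine => //; first exact: regular_dev.
  move=> x /andP[x0 x1].
  have -> : pot_dev i l (advance s i x) = A * c0 * expR (l * x).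
    by rewrite /pot_dev /= eqxx -!expRD -natr1; congr expR; ring.
  have -> : A * c0 + A * c0 * (l + 2 * l ^+ 2) * x =
     A * c0 * (1 + l * x + 2 * l ^+ 2 * x) by ring.
  rewrite ler_wpM2l ?mulr_ge0 //.
  have lx : l * x <= 1 / 2.
    apply: le_trans (ler_norm _) _; rewrite normrM (ger0_norm x0).
    have := normr_ge0 l; nra.
  (* The bound x^2 <= x on the unit interval makes the majorant affine in the reward. *)
  apply: le_trans (expR_le_quadratic lx) _; rewrite lerD2l exprMn -mulrA.
  rewrite ler_wpM2l // ler_wpM2l ?sqr_ge0 // expr2 ler_piMr //.
have -> : A * c0 + A * c0 * (l + 2 * l ^+ 2) * mean i =
   A * (c0 * (1 + (l + 2 * l ^+ 2) * mean i)) by ring.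
rewrite -[leRHS]mulr1 ler_wpM2l //.
apply: (@le_trans _ _ (c0 * expR ((l + 2 * l ^+ 2) * mean i))).
  by rewrite ler_wpM2l // expR_ge1Dx.
rewrite -expRD -[leRHS](@expR0 R) ler_expR.
suff : 0 <= l ^+ 2 * (mu - mean i) by lra.
by rewrite mulr_ge0 ?sqr_ge0 // subr_ge0.
Qed.

End potentials.

(** * Failure events and the gap of the pulled arm within one epoch *)

Section epoch_regret.
Variables (R : realType) (k : nat) (nu : 'I_k -> probability (measurableTypeR R) R).
Hypothesis nu01 : forall i, nu i `[0%R, 1%R] = 1%E.
Variables (i0 : 'I_k) (w : nat) (star : 'I_k).
Local Notation state := (state R k).
Local Notation mean := (arm_mean nu).
Local Notation play_step := (play_step nu i0).
Local Notation play := (play nu i0).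
Local Notation reachable := (@reachable R k w).
Local Notation policy_mean := (policy_mean nu i0).
Implicit Types (s : state) (g : state -> R) (i j : 'I_k).
Local Notation mu := (mean star).
Local Notation L := (ln w%:R : R).
Hypothesis mean_le : forall i, mean i <= mu.
Hypothesis mu_gt0 : 0 < mu.
Hypothesis L_gt0 : 0 < L.

Let L_ge0 : 0 <= L := ltW L_gt0.
Let mu_ge0 : 0 <= mu := ltW mu_gt0.

Local Notation pot_still1 := (pot_still1 star).
Local Notation pot_short := (pot_short nu w star).
Local Notation pot_dev := (pot_dev nu star).
Local Notation threshold := (threshold R w).
Local Notation enough := (enough R w).

Let enough_gt0 : 0 < enough.
Proof. by rewrite /enough mulr_gt0 ?ltr0n. Qed.

(* Optimal tilting for a deviation of size [6 sqrt(L m)] at [m = n mu]. *)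
Definition tilt (n : nat) : R :=
  if enough <= mu * n%:R then 3 / 2 * Num.sqrt (L * (mu * n%:R)) / (mu * n%:R) else 0.

(** Squared, it asks for 900 L <= m, and [enough] is 1200 L. Thus a deviation 6 sqrt(L m) is at most
    m/5, and a gap 18 sqrt(L m) at most 3/5 m. *)
Lemma sqrt_le_enough (m : R) : enough <= m -> 30 * Num.sqrt (L * m) <= m.
Proof.
move=> Hm; have m0 : 0 <= m by apply: le_trans Hm; exact: ltW.
have S0 : 0 <= 30 * Num.sqrt (L * m) by rewrite mulr_ge0 ?ler0n ?sqrtr_ge0.
rewrite -(@ler_pXn2r _ 2) ?nnegrE // exprMn sqr_sqrtr; last exact: mulr_ge0.
rewrite [leRHS]expr2 mulrA ler_wpM2r //; apply: le_trans Hm.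
by rewrite /enough; have := L_ge0; lra.
Qed.

Lemma tilt_itv n : 0 <= tilt n <= 1 / 2.
Proof.
rewrite /tilt; case: ifP => Hm; last by lra.
have m0 : 0 < mu * n%:R by exact: lt_le_trans enough_gt0 Hm.
have := sqrt_le_enough Hm; set D := Num.sqrt _ => HD.
have D0 : 0 <= D by exact: sqrtr_ge0.
rewrite divr_ge0 ?(ltW m0) ?mulr_ge0 //= ler_pdivrMr //; lra.
Qed.

(** The best tilting depends on the random number of pulls, so all possible counts up to [w] are
    summed, with both signs; one summand is tuned to the actual count. *)
Definition pot_devs s : R :=
  \sum_(i < k) \sum_(n < w.+1) (pot_dev i (tilt n) s + pot_dev i (- tilt n) s).

Lemma regular_devs : regular pot_devs.
Proof.
apply: regular_sum => i; apply: regular_sum => n.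
by apply: regularD; exact: regular_dev.
Qed.

Lemma step_devs t s : reachable t s -> play_step pot_devs s <= pot_devs s.
Proof.
move=> Hs; have vs := reachable_valid Hs.
have rd i l : regular (pot_dev i l) by exact: regular_dev.
have rp i n : regular (fun s => pot_dev i (tilt n) s + pot_dev i (- tilt n) s).
  exact: regularD.
rewrite play_step_sum //; last by move=> i; exact: regular_sum.
apply: ler_sum => i _; rewrite play_step_sum //; apply: ler_sum => n _.
have /andP[t0 t1] := tilt_itv n.
by rewrite play_stepD //; apply: lerD; apply: step_dev Hs => //;
  rewrite ?normrN ger0_norm.
Qed.

(** At the tilting matching the count, a deviation of 6 sqrt(L m) gives exponent at least 9 L - 9/2
    L, which exceeds 4 L; the sign of the tilting follows that of the deviation. *)
Lemma dev_certificate t s i : reachable t s -> (t <= w)%N ->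
  enough <= mu * (cnt s i)%:R ->
  6 * Num.sqrt (L * (mu * (cnt s i)%:R)) < `|rsum s i - mean i * (cnt s i)%:R| ->
  expR (4 * L) <= pot_devs s.
Proof.
move=> Hs tw Hm Hd.
have nw : (cnt s i < w.+1)%N by rewrite ltnS (leq_trans (reachable_cnt_le i Hs)).
have e0 j l : 0 <= pot_dev j l s by exact: expR_ge0.
have -> : pot_devs s = \sum_(i < k) \sum_(n < w.+1)
  (pot_dev i (tilt n) s + pot_dev i (- tilt n) s) by [].
rewrite (bigD1 i) //= (bigD1 (Ordinal nw)) //= -addrA; apply: ler_wpDr.
  apply: addr_ge0; apply: sumr_ge0 => *; last apply: sumr_ge0 => *; exact: addr_ge0.
move: Hd; rewrite /pot_dev /tilt Hm sqrrN.
set m := mu * (cnt s i)%:R in Hm *; set D := Num.sqrt _; set d := rsum s i - _ => Hd.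
have m0 : 0 < m by exact: lt_le_trans enough_gt0 Hm.
have D2 : D ^+ 2 = L * m by rewrite sqr_sqrtr // mulr_ge0 // ltW.
have D0 : 0 <= D by exact: sqrtr_ge0.
have bound (y : R) : 6 * D < y ->
    expR (4 * L) <= expR (3 / 2 * D / m * y - 2 * (3 / 2 * D / m) ^+ 2 * mu * (cnt s i)%:R).
  move=> Hy; rewrite ler_expR -[2 * _ * mu * _]mulrA -/m.
  have -> : 2 * (3 / 2 * D / m) ^+ 2 * m = 9 / 2 * (D ^+ 2 / m) by field; rewrite gt_eqF.
  have -> : D ^+ 2 / m = L by rewrite D2 mulfK // gt_eqF.
  have : 3 / 2 * D / m * (6 * D) <= 3 / 2 * D / m * y.
    by rewrite ler_wpM2l ?(ltW Hy) // divr_ge0 ?(ltW m0) // mulr_ge0.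
  have -> : 3 / 2 * D / m * (6 * D) = 9 * (D ^+ 2 / m) by field; rewrite gt_eqF.
  have -> : D ^+ 2 / m = L by rewrite D2 mulfK // gt_eqF.
  by have := L_ge0; lra.
have [d0|d0] := leP 0 d.
  by move: Hd; rewrite ger0_norm // => /bound H; apply: ler_wpDr; rewrite ?expR_ge0.
move: Hd; rewrite ltr0_norm // => /bound; rewrite mulrN -mulNr => H.
by apply: ler_wpDl; rewrite ?expR_ge0.
Qed.

(** Markov majorant of the failure indicator: each summand reaches 1 when its own failure occurs,
    and each is controlled in expectation. *)
Definition bad s : R :=
  expR threshold * pot_still1 s + (expR (- (4 * L)) * pot_short s +
  expR (- (4 * L)) * pot_devs s).

Lemma regular_bad : regular bad.
Proof.
apply: regularD; first by apply: regularZ; [exact: expR_ge0|exact: regular_still1].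
by apply: regularD; (apply: regularZ; [exact: expR_ge0|]);
  [exact: regular_short|exact: regular_devs].
Qed.

Definition well_behaved s :=
  [/\ ~~ in_phase1 s, forall i, enough <= mu * (cnt s i)%:R &
      forall i, `|rsum s i - mean i * (cnt s i)%:R| <=
                6 * Num.sqrt (L * (mu * (cnt s i)%:R))].

Lemma bad_or_well_behaved t s : reachable t s -> (t <= w)%N ->
  1 <= bad s \/ well_behaved s.
Proof.
move=> Hs tw; have [Ws _ _ _ _] := Hs.
have g1 : 0 <= expR threshold * pot_still1 s.
  by rewrite mulr_ge0 ?expR_ge0 //; case: (regular_still1 R star).
have g2 : 0 <= expR (- (4 * L)) * pot_short s.
  by rewrite mulr_ge0 ?expR_ge0 //; case: (regular_short nu w star).
have g3 : 0 <= expR (- (4 * L)) * pot_devs s.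
  by rewrite mulr_ge0 ?expR_ge0 //; case: regular_devs.
have [ps|ps] := boolP (in_phase1 s).
  left; rewrite /bad -[leLHS]addr0 lerD ?addr_ge0 //.
  have /andP[p1 /bigmax_leP[_ H]] := ps.
  rewrite /pot_still1 p1 -expRD -[leLHS](@expR0 R) ler_expR subr_ge0.
  by have := H star isT; rewrite Ws.
have [[b Hb]|/forallNP Hc] := pselect (exists b, mu * (cnt s b)%:R < enough).
  left; rewrite /bad; suff : 1 <= expR (- (4 * L)) * pot_short s by lra.
  apply: (@le_trans _ _ (expR (- (4 * L)) * expR (threshold / 3 - enough))).
    (* In units of L the exponent is 3780/3 - 1200 - 4 = 56. *)
    rewrite -expRD -[leLHS](@expR0 R) ler_expR /threshold /enough /cNCB.
    by have := L_ge0; lra.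
  rewrite ler_wpM2l ?expR_ge0 //.
  apply: le_trans (short_certificate nu star L_ge0 Hs ps).
  rewrite (bigD1 b) //= Hb [true%:R * _]mul1r lerDl.
  by apply: sumr_ge0 => *; rewrite mulr_ge0 ?expR_ge0.
have Hm i : enough <= mu * (cnt s i)%:R by rewrite leNgt; apply/negP; exact: Hc.
have [[i Hi]|/forallNP Hd] := pselect (exists i,
  6 * Num.sqrt (L * (mu * (cnt s i)%:R)) < `|rsum s i - mean i * (cnt s i)%:R|).
  left; rewrite /bad; suff : 1 <= expR (- (4 * L)) * pot_devs s by lra.
  have := dev_certificate Hs tw (Hm i) Hi.
  move/(ler_wpM2l (expR_ge0 (- (4 * L)))); apply: le_trans.
  by rewrite -expRD addNr expR0.
by right; split => // i; rewrite leNgt; apply/negP; exact: Hd.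
Qed.

(** Multiplying by the count expresses the index in terms of the reward sum, the scale on which
    deviations are measured. *)
Lemma NCB_scaled t s i : reachable t s -> (0 < cnt s i)%N ->
  (cnt s i)%:R * NCB s i = rsum s i + 6 * Num.sqrt (2 * rsum s i * L).
Proof.
move=> [Ws _ _ vs _] n0; have /andP[r0 _] := vs i.
have n0' : 0 < (cnt s i)%:R :> R by rewrite ltr0n.
rewrite /NCB /emp_mean /cNCB Ws; set n := (cnt s i)%:R.
have -> : 2 * (rsum s i / n) * L / n = 2 * rsum s i * L / n ^+ 2.
  by field; rewrite gt_eqF.
rewrite sqrtrM ?mulr_ge0 // sqrtrV ?sqr_ge0 // sqrtr_sqr gtr0_norm //.
by field; rewrite gt_eqF.
Qed.

(** The best arm has index at least [mu], hence so has the pulled arm. With D = sqrt(L mu n), the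
    confidence width of the pulled arm is at most 12 D and its deviation at most 6 D; finally 18 D
    <= 3/5 mu n. *)
Lemma pulled_gap t s : reachable t s -> well_behaved s ->
  let n : R := (cnt s (ncb_arm i0 s))%:R in
  [/\ 0 < n, policy_mean s = mean (ncb_arm i0 s),
      n * (mu - mean (ncb_arm i0 s)) <= 18 * Num.sqrt (L * (mu * n)) &
      mu - mean (ncb_arm i0 s) <= 3 / 5 * mu].
Proof.
move=> Hs [ps Hm Hd] n; set I := ncb_arm i0 s in n *.
have [Ws _ us vs _] := Hs.
have e0 := enough_gt0.
have cnt0 i : (0 < cnt s i)%N.
  have := lt_le_trans e0 (Hm i); case: (cnt s i) => //; by rewrite mulr0 ltxx.
have n0 : 0 < n by rewrite ltr0n.
have opt : mu <= NCB s I.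
  apply: (@le_trans _ _ (NCB s star)); last first.
    by rewrite /I /ncb_arm; case: arg_maxP => // j _; apply.
  have nn0 : 0 < (cnt s star)%:R :> R by rewrite ltr0n.
  rewrite -(ler_pM2l nn0) (NCB_scaled Hs) //.
  have := Hd star; have := sqrt_le_enough (Hm star).
  rewrite ler_norml [mu * _]mulrC; set m := _ * mu; set D := Num.sqrt _.
  move=> HD /andP[H1 _]; have /andP[r0 _] := vs star.
  (* The deviation is at most m/5; with half of [m] guaranteed, the confidence width covers the
     deviation. *)
  have X2 : m <= 2 * rsum s star by lra.
  suff : D <= Num.sqrt (2 * rsum s star * L) by lra.
  by rewrite ler_wsqrtr // [_ * L]mulrC ler_wpM2l.
have gap : n * (mu - mean I) <= 18 * Num.sqrt (L * (mu * n)).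
  move: opt; rewrite -(ler_pM2l n0) (NCB_scaled Hs) //.
  have := Hd I; have := sqrt_le_enough (Hm I).
  rewrite -/n [mu * n]mulrC; set D := Num.sqrt (L * (n * mu)).
  have D0 : 0 <= D by exact: sqrtr_ge0.
  rewrite ler_norml => HD /andP[_ H2] H.
  have /andP[r0 _] := vs I.
  have mn : n * mean I <= n * mu by rewrite ler_pM2l.
  have X2 : rsum s I <= 2 * (n * mu) by lra.
  have : Num.sqrt (2 * rsum s I * L) <= 2 * D.
    rewrite -[2 * D]ger0_norm ?mulr_ge0 // -sqrtr_sqr ler_wsqrtr //.
    rewrite exprMn sqr_sqrtr; last by rewrite !mulr_ge0 // ltW.
    have -> : 2 ^+ 2 * (L * (n * mu)) = 2 * (2 * (n * mu)) * L by ring.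
    by rewrite ler_wpM2r // ler_wpM2l.
  by lra.
split => //.
  rewrite /policy_mean (bigD1 I) //= big1 ?addr0.
    by rewrite /policy us (negbTE ps) eqxx mul1r.
  by move=> i ne; rewrite /policy us (negbTE ps) (negbTE ne) mul0r.
rewrite -(ler_pM2l n0); apply: le_trans gap _.
have := sqrt_le_enough (Hm I); rewrite -/n; lra.
Qed.

(** * The square-root potential and the expected regret of a round *)

Definition pot_sqrt s : R := \sum_(i < k) Num.sqrt (cnt s i)%:R.

Lemma regular_pot_sqrt : regular pot_sqrt.
Proof.
apply: (regular_cnt (F := fun c => \sum_(i < k) Num.sqrt (c i)%:R)) => c.
by apply: sumr_ge0 => i _; exact: sqrtr_ge0.
Qed.

Lemma step_pot_sqrt s : play_step pot_sqrt s =
  pot_sqrt s + \sum_(i < k) policy i0 s i *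
    (Num.sqrt (cnt s i).+1%:R - Num.sqrt (cnt s i)%:R).
Proof.
rewrite -[pot_sqrt s]mul1r -{1}(sum_policy i0 s) mulr_suml -big_split /=.
apply: eq_bigr => i _; rewrite -mulrDr; congr (_ * _).
rewrite -[RHS](@expect_cst R (nu i)); congr fine; apply: eq_integral => x _.
congr EFin; rewrite /pot_sqrt (bigD1 i) //= eqxx [in RHS](bigD1 i) //=.
rewrite (eq_bigr (fun j => Num.sqrt (cnt s j)%:R)); last by move=> j /negbTE ->.
by ring.
Qed.

(** The difference is the inverse of sqrt(n+1) + sqrt(n), and sqrt(n+1) <= 2 sqrt(n). *)
Lemma sqrt_succ_sub (n : nat) : (0 < n)%N ->
  1 <= 3 * Num.sqrt n%:R * (Num.sqrt n.+1%:R - Num.sqrt n%:R) :> R.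
Proof.
move=> n0; have n1 : 1 <= n%:R :> R by rewrite ler1n.
set a : R := Num.sqrt n%:R; set b : R := Num.sqrt n.+1%:R.
have a2 : a ^+ 2 = n%:R by rewrite sqr_sqrtr.
have b2 : b ^+ 2 = n%:R + 1 by rewrite sqr_sqrtr // natr1.
have a0 : 0 <= a by exact: sqrtr_ge0.
have b0 : 0 <= b by exact: sqrtr_ge0.
have a1 : 1 <= a by rewrite -[leLHS](@sqrtr1 R) ler_wsqrtr.
have ab : a <= b by rewrite ler_wsqrtr // ler_nat.
have ba : b <= 2 * a.
  rewrite -(@ler_pXn2r _ 2) ?nnegrE ?mulr_ge0 // exprMn a2 b2; lra.
have e : (b - a) * (b + a) = 1 by rewrite -subr_sqr a2 b2; ring.
have : (b - a) * (b + a) <= (b - a) * (3 * a).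
  by rewrite ler_wpM2l ?subr_ge0 //; lra.
by rewrite e; lra.
Qed.

Lemma step_pot_sqrt_ge s : pot_sqrt s <= play_step pot_sqrt s.
Proof.
rewrite step_pot_sqrt lerDl; apply: sumr_ge0 => i _.
by rewrite mulr_ge0 ?policy_ge0 // subr_ge0 ler_wsqrtr // ler_nat.
Qed.

(** On failure [mu * bad] already covers [mu]; otherwise [pulled_gap] applies, with 54 = 18 * 3 by
    [sqrt_succ_sub]. No subtraction is used, so both sides are sums of regular functions, which must
    be nonnegative. *)
Lemma round_regret t s : reachable t s -> (t <= w)%N ->
  mu + 54 * Num.sqrt (L * mu) * pot_sqrt s <=
    policy_mean s + mu * bad s + 54 * Num.sqrt (L * mu) * play_step pot_sqrt s /\
  mu <= policy_mean s + mu * bad s + 3 / 5 * mu.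
Proof.
move=> Hs tw.
have c0 : 0 <= 54 * Num.sqrt (L * mu) by rewrite mulr_ge0 ?ler0n ?sqrtr_ge0.
have pm0 : 0 <= policy_mean s by case: (regular_policy_mean nu01 i0).
have b0 : 0 <= bad s by case: regular_bad.
have mono := ler_wpM2l c0 (step_pot_sqrt_ge s).
have mm := mu_ge0.
case: (bad_or_well_behaved Hs tw) => [b1|gs].
  have : mu * 1 <= mu * bad s by rewrite ler_wpM2l.
  by rewrite mulr1 => ?; split; lra.
have mb0 : 0 <= mu * bad s by rewrite mulr_ge0.
have [n0 -> gap gap'] := pulled_gap Hs gs; split; last by lra.
have [ps _ _] := gs; have [_ _ us _ _] := Hs.
rewrite step_pot_sqrt (bigD1 (ncb_arm i0 s)) //= big1 ?addr0; last first.
  by move=> i ne; rewrite /policy us (negbTE ps) (negbTE ne) mul0r.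
rewrite /policy us (negbTE ps) eqxx /= mul1r.
have := sqrt_succ_sub (n := cnt s (ncb_arm i0 s)).
rewrite -(ltr0n R) => /(_ n0).
move: gap; set n : R := (cnt s _)%:R; set a := Num.sqrt n.
set D := _ - a; move=> gap HD.
have a0 : 0 < a by rewrite sqrtr_gt0.
have a2 : a ^+ 2 = n by rewrite sqr_sqrtr // ltW.
suff : mu - mean (ncb_arm i0 s) <= 54 * Num.sqrt (L * mu) * D by lra.
rewrite -(ler_pM2l n0); apply: le_trans gap _.
rewrite [L * (mu * n)]mulrA sqrtrM -/a; last exact: mulr_ge0.
rewrite -[X in _ <= X * _]a2.
have : 18 * Num.sqrt (L * mu) * a * 1 <= 18 * Num.sqrt (L * mu) * a * (3 * a * D).
  by rewrite ler_wpM2l // !mulr_ge0 ?sqrtr_ge0.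
by lra.
Qed.

Local Notation start := (fresh R k w false).

Lemma play_round_regret n : (n <= w)%N ->
  mu + 54 * Num.sqrt (L * mu) * play n pot_sqrt start <=
    play n policy_mean start + mu * play n bad start +
    54 * Num.sqrt (L * mu) * play n.+1 pot_sqrt start /\
  mu <= play n policy_mean start + mu * play n bad start + 3 / 5 * mu.
Proof.
move=> nw; have Hs := reachable_fresh R k w.
have c0 : 0 <= 54 * Num.sqrt (L * mu) by rewrite mulr_ge0 ?ler0n ?sqrtr_ge0.
have rp := regular_policy_mean nu01 i0; have rb := regular_bad.
have rs := regular_pot_sqrt; have rss := regular_play_step nu01 i0 rs.
have rmb : regular (fun s => mu * bad s) by exact: regularZ.
(* The last round is moved inside, so that the one-round inequality can be averaged over the state
   after [n] rounds. *)
have -> : play n.+1 pot_sqrt start = play n (play_step pot_sqrt) start.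
  by rewrite /play iterSr.
split.
  rewrite -[X in X + _ <= _](@play_cst _ _ nu i0 n mu start).
  rewrite -!(playZ nu01 i0 n _ _ Hs) // -!(playD nu01 i0 n _ _ Hs) //;
    try by [exact: regular_cst|exact: regularZ|exact: regularD].
  apply: (play_le nu01 i0 _ _ Hs) => [||s' Hs'].
  - by apply: regularD; [exact: regular_cst|exact: regularZ].
  - by apply: regularD; [exact: regularD|exact: regularZ].
  - exact: (round_regret Hs' nw).1.
rewrite -[leLHS](@play_cst _ _ nu i0 n mu start).
rewrite -[3 / 5 * mu](@play_cst _ _ nu i0 n _ start).
have r3 : regular (fun _ : state => 3 / 5 * mu) by apply: regular_cst; rewrite mulr_ge0.
rewrite -!(playZ nu01 i0 n _ _ Hs) // -!(playD nu01 i0 n _ _ Hs) //; try exact: regularD.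
apply: (play_le nu01 i0 _ _ Hs) => [||s' Hs'].
- exact: regular_cst.
- by apply: regularD => //; exact: regularD.
- exact: (round_regret Hs' nw).2.
Qed.

(** The first term is the geometric decay, by (1 - y)^n <= exp(-n y). The others are initial values:
    [k] squared pairs, and two tiltings for each arm and count. *)
Lemma play_bad n : play n bad start <=
  expR (threshold - n%:R * (mu / (2 * k%:R))) +
  expR (- (4 * L)) * (k%:R ^+ 2 + 2 * k%:R * w.+1%:R).
Proof.
have Hs := reachable_fresh R k w.
have k1 : 1 <= k%:R :> R by rewrite ler1n; exact: leq_ltn_trans (leq0n i0) (ltn_ord i0).
have /andP[_ mu1] := mean_itv nu01 star; have mm := mu_ge0.
have r1 := regular_still1 R star; have r2 := regular_short nu w star.
have r3 := regular_devs.
have z1 : regular (fun s => expR threshold * pot_still1 s).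
  by apply: regularZ => //; exact: expR_ge0.
have z2 : regular (fun s => expR (- (4 * L)) * pot_short s).
  by apply: regularZ => //; exact: expR_ge0.
have z3 : regular (fun s => expR (- (4 * L)) * pot_devs s).
  by apply: regularZ => //; exact: expR_ge0.
rewrite /bad !(playD nu01 i0 n _ _ Hs) //; last exact: regularD.
rewrite !(playZ nu01 i0 n _ _ Hs) ?expR_ge0 //; apply: lerD.
  rewrite expRD ler_wpM2l ?expR_ge0 //.
  have y0 : 0 <= 1 - mu / (2 * k%:R) by rewrite subr_ge0 ler_pdivrMr; lra.
  apply: (@le_trans _ _ ((1 - mu / (2 * k%:R)) ^+ n * pot_still1 start)).
    apply: (play_geom nu01 n _ _ Hs) => // t' s' Hs'.
    exact: step_still1 Hs'.
  rewrite /pot_still1 /= oppr0 expR0 mulr1 -[- (n%:R * _)]mulrN expRM_natl.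
  by rewrite lerXn2r ?nnegrE ?expR_ge0 // expR_ge1Dx.
rewrite -mulrDr ler_wpM2l ?expR_ge0 //; apply: lerD.
  apply: (@le_trans _ _ (pot_short start)).
    apply: (play_supermartingale nu01 n _ Hs) => // t' s' Hs'.
    exact: step_short Hs'.
  rewrite /pot_short /= /pot_short_pair /=.
  under eq_bigr => a _ do under eq_bigr => b _ do rewrite mul0r mulr0 subr0 expR0.
  by rewrite !sumr_const !card_ord -mulrnA expr2 -natrM.
apply: (@le_trans _ _ (pot_devs start)).
  apply: (play_supermartingale nu01 n _ Hs) => // t' s' Hs'.
  exact: step_devs Hs'.
rewrite /pot_devs /pot_dev /=.
under eq_bigr => a _ do under eq_bigr => b _ do
  rewrite !(mulr0, subr0, expR0).
rewrite !sumr_const !card_ord -[_ *+ _ *+ _]mulr_natl -[_ *+ _]mulr_natl.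
by rewrite le_eqVlt; apply/orP; left; apply/eqP; ring.
Qed.

(** Cauchy-Schwarz in every state: the [k] counts add up to [n], which is at most [w]. *)
Lemma play_pot_sqrt n : (0 < w)%N -> (n <= w)%N ->
  0 <= play n pot_sqrt start <= Num.sqrt (k%:R * w%:R).
Proof.
move=> w0 nw; have Hs := reachable_fresh R k w.
have k1 : 0 < k%:R :> R by rewrite ltr0n; exact: leq_ltn_trans (leq0n i0) (ltn_ord i0).
have w0' : 0 < w%:R :> R by rewrite ltr0n.
apply/andP; split; first by apply: play_ge0; case: regular_pot_sqrt.
rewrite -[leRHS](@play_cst _ _ nu i0 n _ start).
apply: (play_le nu01 i0 _ _ Hs) => [||s' Hs'].
- exact: regular_pot_sqrt.
- by apply: regular_cst; exact: sqrtr_ge0.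
have [_ _ _ _ cs] := Hs'.
set S := Num.sqrt (k%:R * w%:R).
have S0 : 0 < S by rewrite sqrtr_gt0 mulr_gt0.
have S2 : S ^+ 2 = k%:R * w%:R by rewrite sqr_sqrtr // mulr_ge0 // ltW.
(* AM-GM: [2 S sqrt c <= k c + S^2 / k] *)
have amgm i : 2 * S * Num.sqrt (cnt s' i)%:R <= k%:R * (cnt s' i)%:R + w%:R.
  set c := Num.sqrt _.
  have c2 : c ^+ 2 = (cnt s' i)%:R by rewrite sqr_sqrtr.
  have : 0 <= k%:R * (c - S / k%:R) ^+ 2 by rewrite mulr_ge0 ?sqr_ge0 // ltW.
  have -> : k%:R * (c - S / k%:R) ^+ 2 = k%:R * c ^+ 2 - 2 * S * c + S ^+ 2 / k%:R.
    by field; rewrite gt_eqF.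
  have -> : S ^+ 2 / k%:R = w%:R by rewrite S2 mulrC mulKf // gt_eqF.
  by rewrite c2; lra.
have : \sum_(i < k) 2 * S * Num.sqrt (cnt s' i)%:R <=
       \sum_(i < k) (k%:R * (cnt s' i)%:R + w%:R) by apply: ler_sum => i _.
rewrite -mulr_sumr big_split /= -mulr_sumr -natr_sum cs add0n sumr_const card_ord.
rewrite -[w%:R *+ k]mulr_natl -S2 => H.
have nw' : k%:R * n%:R <= k%:R * w%:R :> R by rewrite ler_pM2l // ler_nat.
rewrite -/(pot_sqrt s') in H *.
rewrite -(@ler_pM2l _ (2 * S)) ?mulr_gt0 //.
apply: le_trans H _; rewrite -S2 in nw'; lra.
Qed.

End epoch_regret.

(** * Estimates for logarithms and the size of the horizon *)

Section logarithm.
Variable R : realType.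

(** The quadratic bound gives exp(1/2) <= 1 + 1/2 + 1/2 = 2. *)
Lemma ln2_ge_half : 1 / 2 <= ln 2 :> R.
Proof.
have h : 1 / 2 <= 1 / 2 :> R by [].
rewrite -(@expRK R (1 / 2)) ler_ln ?posrE ?expR_gt0 ?ltr0n //.
by apply: le_trans (expR_le_quadratic h) _; lra.
Qed.

Lemma ln_pow2 e : ln (2 ^ e)%:R = e%:R * ln 2 :> R.
Proof. by rewrite natrX lnXn ?ltr0n // mulr_natl. Qed.

Lemma le_ln_nat m n : (0 < m)%N -> (m <= n)%N -> ln m%:R <= ln n%:R :> R.
Proof.
by move=> m0 mn; rewrite ler_ln ?posrE ?ltr0n ?ler_nat // (leq_trans m0).
Qed.

(** With u the fourth root of T, ln T <= 4 u and 64 k <= u, so k (4 u)^3 <= u^4. *)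
Lemma ln_cube_le (k T : nat) : (0 < k)%N -> ((64 * k) ^ 4 <= T)%N ->
  k%:R * ln T%:R ^+ 3 <= T%:R :> R.
Proof.
move=> k0 kT; set u : R := Num.sqrt (Num.sqrt T%:R).
have u4 : u ^+ 4 = T%:R by rewrite (exprM u 2 2) !sqr_sqrtr ?sqrtr_ge0.
have ku : 64 * k%:R <= u.
  rewrite -(@ler_pXn2r _ 4) ?nnegrE ?sqrtr_ge0 ?mulr_ge0 ?ler0n // u4.
  by rewrite -natrM -natrX ler_nat.
have u0 : 0 < u by apply: lt_le_trans ku; rewrite mulr_gt0 ?ltr0n.
have lu : ln T%:R <= 4 * u.
  rewrite -u4 lnXn // -[_ *+ 4]mulr_natl ler_wpM2l ?ler0n //.
  exact: ltW (ln_sublinear u0).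
have T1 : 1 <= T%:R :> R.
  by rewrite ler1n; apply: leq_trans kT; rewrite expn_gt0 muln_gt0 k0.
have l0 : 0 <= ln T%:R :> R by exact: ln_ge0.
have : ln T%:R ^+ 3 <= (4 * u) ^+ 3.
  by rewrite lerXn2r ?nnegrE // mulr_ge0 ?ler0n // ltW.
move=> /(ler_wpM2l (ler0n R k)) H; apply: le_trans H _.
have -> : k%:R * (4 * u) ^+ 3 = (64 * k%:R) * u ^+ 3 by ring.
by rewrite -u4 [u ^+ 4]exprS ler_wpM2r // exprn_ge0 // ltW.
Qed.

Lemma sum_below_le (t : R) n : 0 <= t -> \sum_(j < n) (j%:R < t)%R%:R <= t + 1.
Proof.
move=> t0; elim: n => [|n IH]; first by rewrite big_ord0; lra.
rewrite big_ord_recr /=; have [nt|nt] := ltP n%:R t; last by rewrite addr0.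
have : \sum_(j < n) (j%:R < t)%R%:R <= \sum_(j < n) 1 :> R.
  by apply: ler_sum => j _; rewrite lern1 leq_b1.
by rewrite sumr_const card_ord /= => ?; rewrite [true%:R](_ : _ = 1) //; lra.
Qed.

End logarithm.

(** * Summation of logarithmic losses over rounds and epochs *)

Section anytime.
Variables (R : realType) (k : nat) (nu : 'I_k -> probability (measurableTypeR R) R).
Hypothesis nu01 : forall i, nu i `[0%R, 1%R] = 1%E.
Variables (i0 : 'I_k) (star : 'I_k).
Local Notation mean := (arm_mean nu).
Local Notation mu := (mean star).
Hypothesis mean_le : forall i, mean i <= mu.
Hypothesis mu_gt0 : 0 < mu.
Local Notation x := (exp_pulled_mean nu i0).

Let mu_le1 : mu <= 1.
Proof. by case/andP: (mean_itv nu01 star). Qed.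

Let k_gt0 : 0 < k%:R :> R.
Proof. by rewrite ltr0n; exact: leq_ltn_trans (leq0n i0) (ltn_ord i0). Qed.

Definition log_loss t : R := ln mu - ln (x t).

(** Uses ln(1 + y) <= y at y = (mu - x)/x, where 1/x <= c/mu. *)
Lemma log_loss_le t (V c : R) : 0 < c -> mu / c <= x t -> mu - x t <= V -> 0 <= V ->
  log_loss t <= c * V / mu.
Proof.
move=> c0 hx hV V0; have x0 : 0 < x t by apply: lt_le_trans hx; rewrite divr_gt0.
rewrite /log_loss -ln_div ?posrE //.
have -> : mu / x t = 1 + (mu - x t) / x t by field; rewrite gt_eqF.
apply: le_trans (le_ln1Dx _) _.
  have -> : (mu - x t) / x t = mu / x t - 1 by field; rewrite gt_eqF.
  have : 0 < mu / x t by rewrite divr_gt0.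
  by lra.
rewrite ler_pdivrMr // (le_trans hV) //.
have : c * V / mu * (mu / c) <= c * V / mu * x t.
  by rewrite ler_wpM2l // divr_ge0 ?mulr_ge0 // ltW.
by have -> : c * V / mu * (mu / c) = V by field; rewrite !gt_eqF.
Qed.

Section one_epoch.
Variables (e : nat).
Local Notation w := (2 ^ e)%N.
Local Notation d := (w%:R ^- 2 : R).
Local Notation q j := (play nu i0 j (policy_mean nu i0) (fresh R k w false)).

Let w_gt0 : (0 < w)%N.
Proof. by rewrite expn_gt0. Qed.

Let w_ge1 : 1 <= w%:R :> R.
Proof. by rewrite ler1n. Qed.

Let d_itv : 0 < d <= 1.
Proof.
have w1 : 1 <= w%:R ^+ 2 :> R by exact: exprn_ege1.
have w0 : 0 < w%:R ^+ 2 :> R := lt_le_trans ltr01 w1.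
by rewrite invr_gt0 w0 invf_le1.
Qed.

Let avg_ge : mu / k%:R <= k%:R^-1 * \sum_(i < k) mean i.
Proof.
rewrite mulrC ler_wpM2l ?invr_ge0 // (bigD1 star) //= lerDl sumr_ge0 // => i _.
by case/andP: (mean_itv nu01 i).
Qed.

Let q_ge0 j : 0 <= q j.
Proof. by apply: play_ge0; case: (regular_policy_mean nu01 i0). Qed.

(** Keeps only the uniform branch, of probability w^-2, and in it the best arm, of probability
    1/k. *)
Lemma exp_pulled_mean_crude j : (j < w)%N -> mu / (k%:R * w%:R ^+ 2) <= x (w + j).
Proof.
move=> jw; rewrite exp_pulled_meanE //; have /andP[d0 d1] := d_itv.
have -> : mu / (k%:R * w%:R ^+ 2) = d * (mu / k%:R).
  by field; rewrite !gt_eqF // ltr0n.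
apply: ler_wpDr; first by rewrite mulr_ge0 ?q_ge0 // subr_ge0.
by rewrite ler_pM2l.
Qed.

Lemma log_loss_crude (T j : nat) : (j < w)%N -> (w <= T)%N -> (k <= T)%N ->
  log_loss (w + j) <= 3 * ln T%:R.
Proof.
move=> jw wT kT; have T0 : (0 < T)%N := leq_trans w_gt0 wT.
have T0' : 0 < T%:R :> R by rewrite ltr0n.
have w0' : 0 < w%:R :> R by rewrite ltr0n.
have h := exp_pulled_mean_crude jw.
have p0 : 0 < mu / (k%:R * w%:R ^+ 2).
  by rewrite divr_gt0 // mulr_gt0 // exprn_gt0.
have x0 := lt_le_trans p0 h.
rewrite /log_loss -ln_div ?posrE // mulr_natl -lnXn //.
rewrite ler_ln ?posrE ?divr_gt0 ?exprn_gt0 // ler_pdivrMr //.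
have : mu <= T%:R ^+ 3 * (mu / (k%:R * w%:R ^+ 2)).
  rewrite mulrA ler_pdivlMr ?mulr_gt0 ?exprn_gt0 // [leRHS]mulrC ler_pM2l //.
  rewrite [T%:R ^+ 3]exprS ler_pM ?exprn_ge0 ?ler0n ?ler_nat //.
  by rewrite lerXn2r ?nnegrE ?ler0n ?ler_nat.
by move=> H; apply: le_trans H _; rewrite ler_wpM2l // exprn_ge0 // ltW.
Qed.

(** Gives k <= w and w^-2 <= 1/100; shorter epochs are left to the crude bound. *)
Hypothesis w_large : (k + 10 <= w)%N.
Local Notation L := (ln w%:R : R).
Local Notation psi j := (play nu i0 j (@pot_sqrt R k) (fresh R k w false)).

Let L_gt0 : 0 < L.
Proof. by rewrite ln_gt0 // ltr1n; lia. Qed.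

Let ten_le : 10 <= w%:R :> R.
Proof. by rewrite ler_nat; lia. Qed.

(** By then the decay contributes 4000 L against a threshold of 3780 L, more than the 2 L needed;
    the initial values total at most 5 w^2, scaled by w^-4. *)
Lemma play_bad_le j : 8000 * k%:R * L / mu <= j%:R ->
  play nu i0 j (bad nu w star) (fresh R k w false) <= 6 * d.
Proof.
move=> hj; apply: le_trans (play_bad nu01 i0 mean_le mu_gt0 L_gt0 j) _.
have w0' : 0 < w%:R :> R by rewrite ltr0n.
have eN n : expR (- (n%:R * L)) = (w%:R ^+ n)^-1.
  by rewrite expRN expRM_natl lnK ?posrE.
have -> : 6 * d = d + 5 * d by ring.
apply: lerD.
  rewrite -(eN 2) ler_expR /threshold /cNCB.
  have : 8000 * k%:R * L / mu * (mu / (2 * k%:R)) <= j%:R * (mu / (2 * k%:R)).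
    by rewrite ler_wpM2r // divr_ge0 ?mulr_ge0 ?ler0n // ltW.
  have -> : 8000 * k%:R * L / mu * (mu / (2 * k%:R)) = 4000 * L.
    by field; rewrite !gt_eqF.
  by have := L_gt0; lra.
rewrite (eN 4) mulrC ler_pdivrMr ?exprn_gt0 //.
have -> : 5 * d * w%:R ^+ 4 = 5 * w%:R ^+ 2 by field; rewrite gt_eqF.
have kw : k%:R <= w%:R :> R by rewrite ler_nat (leq_trans (leq_addr 10 k)).
have k2 : k%:R ^+ 2 <= w%:R ^+ 2 :> R by rewrite lerXn2r ?nnegrE ?ler0n.
have : 2 * k%:R * w.+1%:R <= 2 * w%:R * (2 * w%:R) :> R.
  rewrite ler_pM ?mulr_ge0 ?ler0n //; first by rewrite ler_wpM2l ?ler0n.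
  by rewrite -natr1; have := ten_le; lra.
by lra.
Qed.

Lemma psi_mono j : psi j <= psi j.+1.
Proof.
rewrite /play iterSr; apply: (play_le nu01 i0 _ _ (reachable_fresh R k w)).
- exact: regular_pot_sqrt.
- exact/regular_play_step/regular_pot_sqrt.
- by move=> s' _; exact: step_pot_sqrt_ge.
Qed.

(** [bad] costs 6 w^-2 and the uniform branch one more, 7 in all. As 3/5 + 7/100 < 3/4, the mean
    stays above mu/4, so [log_loss_le] multiplies by 4: 28 = 4 * 7 and 216 = 4 * 54. *)
Lemma log_loss_late j : (j < w)%N -> 8000 * k%:R * L / mu <= j%:R ->
  log_loss (w + j) <= 28 * d + 216 * Num.sqrt (L * mu) / mu * (psi j.+1 - psi j).
Proof.
move=> jw hj; have hb := play_bad_le hj; have /andP[d0 d1] := d_itv.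
have [r1 r2] := play_round_regret nu01 i0 mean_le mu_gt0 L_gt0 (ltnW jw).
move: r1 r2 (psi_mono j); set B := play nu i0 j (bad _ _ _) _ in hb *.
set p1 := psi j.+1; set p0 := psi j => r1 r2 p01.
have mB : mu * B <= 6 * d * mu by rewrite mulrC ler_pM2r.
have c0 : 0 <= 54 * Num.sqrt (L * mu) by rewrite mulr_ge0 ?ler0n ?sqrtr_ge0.
have := exp_pulled_meanE nu i0 jw; set X := x (w + j).
set a := k%:R^-1 * _; move=> EX.
have a0 : 0 <= a by apply: le_trans avg_ge; rewrite divr_ge0 // ltW.
have dw : d <= 1 / 100.
  rewrite -(@ler_pM2r _ (w%:R ^+ 2)) ?exprn_gt0 ?ltr0n // mulVf; last first.
    by rewrite gt_eqF // exprn_gt0 ?ltr0n.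
  have : 10 ^+ 2 <= w%:R ^+ 2 :> R by rewrite lerXn2r ?nnegrE ?ler0n.
  by lra.
have cp : 0 <= 54 * Num.sqrt (L * mu) * (p1 - p0) by rewrite mulr_ge0 // subr_ge0.
(* The pulled mean is [d * a + (1 - d) * q j] with [a] nonnegative, so the uniform branch loses at
   most [d * mu]. *)
have mX (U : R) : mu - q j <= U -> 0 <= U -> mu - X <= U + d * mu.
  move=> hU U0; rewrite EX.
  have : (1 - d) * (mu - q j) <= (1 - d) * U by rewrite ler_wpM2l // subr_ge0.
  have : 0 <= d * U by rewrite mulr_ge0 // ltW.
  have : 0 <= d * a by rewrite mulr_ge0 // ltW.
  by lra.
have dm0 : 0 <= d * mu by rewrite mulr_ge0 // ltW.
have dm1 : d * mu <= 1 / 100 * mu by rewrite ler_pM2r.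
have V1 : mu - X <= 7 * d * mu + 54 * Num.sqrt (L * mu) * (p1 - p0).
  apply: (@le_trans _ _ (6 * d * mu + 54 * Num.sqrt (L * mu) * (p1 - p0) + d * mu)).
    by apply: mX; clear EX hb r2 p01 c0 a0 dw dm1 d1; lra.
  by clear mX EX hb r1 r2 mB p01 c0 a0 dw dm1 dm0 d1; lra.
have V2 : mu / 4 <= X.
  have m0 := mu_gt0; have H : mu - X <= 6 * d * mu + 3 / 5 * mu + d * mu.
    by apply: mX; clear EX hb r1 p01 c0 cp V1 a0 dw dm1 d1; lra.
  by clear mX EX hb r1 r2 mB p01 c0 cp V1 a0 dw d1; lra.
have V0 : 0 <= 7 * d * mu + 54 * Num.sqrt (L * mu) * (p1 - p0).
  by clear mX EX hb r1 r2 mB p01 c0 V1 V2 a0 dw dm1 d1; lra.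
have := @log_loss_le (w + j) _ 4 _ V2 V1 V0; rewrite ltr0n => /(_ isT) H.
apply: le_trans H _; rewrite le_eqVlt; apply/orP; left; apply/eqP.
move: d (Num.sqrt (L * mu)) (p1 - p0) => dd S P.
by field; rewrite gt_eqF.
Qed.

(** Early rounds cost 3 ln T each. For the others, at most [w] copies of 28 w^-2 stay below 28, and
    the increments of [psi] telescope to at most sqrt(k w). *)
Lemma epoch_log_loss_large (T J : nat) : (J <= w)%N -> (w <= T)%N -> (k <= T)%N ->
  \sum_(j < J) log_loss (w + j) <=
    (8000 * k%:R * ln T%:R / mu + 1) * (3 * ln T%:R) + 28 +
    216 * Num.sqrt (k%:R * T%:R * ln T%:R) / mu.
Proof.
move=> Jw wT kT; have /andP[d0 d1] := d_itv.
have LT : L <= ln T%:R by exact: le_ln_nat.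
have LT0 : 0 <= ln T%:R :> R by apply: le_trans LT; exact: ltW.
set t1 := 8000 * k%:R * L / mu.
have t10 : 0 <= t1 by rewrite divr_ge0 ?mulr_ge0 ?ler0n // ltW.
set c := 216 * Num.sqrt (L * mu) / mu.
have c0 : 0 <= c by rewrite divr_ge0 ?mulr_ge0 ?ler0n ?sqrtr_ge0 // ltW.
apply: (@le_trans _ _ (\sum_(j < J) ((j%:R < t1)%R%:R * (3 * ln T%:R) +
    (28 * d + c * (psi j.+1 - psi j))))).
  apply: ler_sum => j _; have jw : (j < w)%N := leq_trans (ltn_ord j) Jw.
  have p0 : 0 <= c * (psi j.+1 - psi j) by rewrite mulr_ge0 // subr_ge0 psi_mono.
  have [h|h] := ltP j%:R t1; last by rewrite mul0r add0r log_loss_late.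
  have := log_loss_crude jw wT kT; rewrite [true%:R * _]mul1r; lra.
rewrite big_split /= -mulr_suml -addrA; apply: lerD.
  rewrite ler_wpM2r ?mulr_ge0 ?ler0n //; apply: le_trans (sum_below_le _ t10) _.
  rewrite lerD2r /t1 ler_wpM2r ?invr_ge0 ?(ltW mu_gt0) //.
  by rewrite ler_wpM2l ?mulr_ge0 ?ler0n.
rewrite big_split /= sumr_const card_ord -mulr_sumr; apply: lerD.
  rewrite -[_ *+ J]mulr_natr -mulrA ler_piMr ?ler0n // mulrC ler_pdivrMr ?exprn_gt0 ?ltr0n //.
  rewrite mul1r expr2 -natrM ler_nat (leq_trans Jw) // leq_pmulr //.
have -> : \sum_(j < J) (psi j.+1 - psi j) = psi J - psi 0.
  by rewrite -(big_mkord xpredT (fun j => psi j.+1 - psi j)) telescope_sumr.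
have /andP[_ hJ] := play_pot_sqrt nu01 i0 w_gt0 Jw.
have /andP[h0 _] := play_pot_sqrt nu01 i0 w_gt0 (leq0n w).
apply: (@le_trans _ _ (c * Num.sqrt (k%:R * w%:R))).
  by rewrite ler_wpM2l //; lra.
rewrite /c mulrAC ler_wpM2r ?invr_ge0 ?(ltW mu_gt0) //.
rewrite -[_ * _ * Num.sqrt (k%:R * w%:R)]mulrA ler_wpM2l ?ler0n //.
rewrite -sqrtrM ?mulr_ge0 ?(ltW mu_gt0) ?(ltW L_gt0) // ler_wsqrtr //.
(* The factor [mu] under the root is dropped here, as it is at most 1. *)
have -> : L * mu * (k%:R * w%:R) = mu * (k%:R * w%:R * L) by ring.
apply: (@le_trans _ _ (k%:R * w%:R * L)).
  by rewrite ler_piMl // mulr_ge0 ?(ltW L_gt0).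
by rewrite ler_pM ?mulr_ge0 ?(ltW L_gt0) // ler_pM2l // ler_nat.
Qed.

End one_epoch.

(** Covers long and short epochs at once: an epoch shorter than k + 10 costs at most k + 10 crude
    rounds, and one more comes from rounding in the long ones. *)
Definition epoch_bound (T : nat) : R :=
  (k%:R + 11 + 8000 * k%:R * ln T%:R / mu) * (3 * ln T%:R) + 28 +
    216 * Num.sqrt (k%:R * T%:R * ln T%:R) / mu.

Lemma epoch_log_loss (T e J : nat) : (J <= 2 ^ e)%N -> (2 ^ e <= T)%N -> (k <= T)%N ->
  \sum_(j < J) log_loss (2 ^ e + j) <= epoch_bound T.
Proof.
move=> Je eT kT.
have T1 : 1 <= T%:R :> R by rewrite ler1n; apply: leq_trans eT; rewrite expn_gt0.
have l0 : 0 <= ln T%:R :> R by exact: ln_ge0.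
have l3 : 0 <= 3 * ln T%:R :> R by rewrite mulr_ge0 ?ler0n.
have t0 : 0 <= 8000 * k%:R * ln T%:R / mu * (3 * ln T%:R).
  by rewrite mulr_ge0 ?divr_ge0 ?mulr_ge0 ?ler0n ?l0 ?(ltW mu_gt0).
have s0 : 0 <= 216 * Num.sqrt (k%:R * T%:R * ln T%:R) / mu.
  by rewrite divr_ge0 ?mulr_ge0 ?ler0n ?sqrtr_ge0 // ltW.
have kl : 0 <= k%:R * (3 * ln T%:R) :> R by rewrite mulr_ge0 ?ler0n.
rewrite /epoch_bound; have [h|h] := leqP (k + 10)%N (2 ^ e)%N.
  by apply: le_trans (epoch_log_loss_large h Je eT kT) _; lra.
apply: (@le_trans _ _ (\sum_(j < J) (3 * ln T%:R))).
  apply: ler_sum => j _; apply: log_loss_crude => //.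
  exact: leq_trans (ltn_ord j) Je.
rewrite sumr_const card_ord -mulr_natl.
have : J%:R * (3 * ln T%:R) <= (k%:R + 10) * (3 * ln T%:R) :> R.
  by rewrite ler_wpM2r // -natrD ler_nat (leq_trans Je) // ltnW.
by lra.
Qed.

Lemma sum_log_loss_pow2 (T E : nat) : (2 ^ E <= T)%N -> (k <= T)%N ->
  \sum_(1 <= t < 2 ^ E) log_loss t <= E%:R * epoch_bound T.
Proof.
move=> ET kT; elim: E ET => [|E IH] ET; first by rewrite big_geq // mul0r.
have EE : (2 ^ E <= 2 ^ E.+1)%N by rewrite leq_exp2l.
rewrite (big_cat_nat (n := (2 ^ E)%N)) ?expn_gt0 //= -natr1 mulrDl mul1r.
apply: lerD; first by apply: IH; exact: leq_trans ET.
rewrite -{1}[(2 ^ E)%N]add0n big_addn expnS.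
have -> : (2 * 2 ^ E - 2 ^ E = 2 ^ E)%N by lia.
rewrite big_mkord; under eq_bigr do rewrite addnC.
by apply: epoch_log_loss => //; exact: leq_trans ET.
Qed.

(** There are E complete epochs and a partial one; ln 2 >= 1/2 gives E <= 2 ln T, and T >= 4 gives 1
    <= ln T. *)
Lemma sum_log_loss (T : nat) : (4 <= T)%N -> (k <= T)%N ->
  \sum_(1 <= t < T.+1) log_loss t <= 3 * ln T%:R * epoch_bound T.
Proof.
move=> T4 kT; set E := trunc_log 2 T.
have /andP[ET TE] : (2 ^ E <= T < 2 ^ E.+1)%N by apply: trunc_log_bounds => //; lia.
have B0 : 0 <= epoch_bound T.
  have := @epoch_log_loss T 0 0; rewrite big_ord0 expn0; apply => //; lia.
have ln4 : 1 <= ln T%:R :> R.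
  apply: (@le_trans _ _ (ln (2 ^ 2)%:R)); last exact: le_ln_nat.
  by rewrite ln_pow2; have := ln2_ge_half R; lra.
have lnE : E%:R <= 2 * ln T%:R :> R.
  have := @le_ln_nat R (2 ^ E) T; rewrite expn_gt0 => /(_ isT ET).
  rewrite ln_pow2 => H.
  have : E%:R * (1 / 2) <= E%:R * ln 2 :> R by rewrite ler_wpM2l ?ler0n ?ln2_ge_half.
  by lra.
have E1 : (1 <= 2 ^ E)%N by rewrite expn_gt0.
rewrite (big_cat_nat (n := (2 ^ E)%N)) //=; last exact: leqW.
have H1 := sum_log_loss_pow2 ET kT.
have H2 : \sum_(2 ^ E <= t < T.+1) log_loss t <= epoch_bound T.
  rewrite -{1}[(2 ^ E)%N]add0n big_addn big_mkord; under eq_bigr do rewrite addnC.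
  by apply: epoch_log_loss => //; move: TE; rewrite expnS; lia.
have : (E%:R + 1) * epoch_bound T <= 3 * ln T%:R * epoch_bound T.
  by rewrite ler_wpM2r //; lra.
by lra.
Qed.

(** With S the total loss, the product is exp(T ln mu - S); its T-th root is mu exp(-S/T), at least
    mu (1 - S/T). *)
Lemma prod_exp_pulled_mean (T : nat) : (0 < T)%N ->
  mu - (mu / T%:R) * \sum_(1 <= t < T.+1) log_loss t <=
  powR (\prod_(1 <= t < T.+1) x t) (T%:R^-1).
Proof.
move=> T0; have T0' : 0 < T%:R :> R by rewrite ltr0n.
have x0 t : (0 < t)%N -> 0 < x t.
  move=> t0; have /andP[h1 h2] := trunc_log_bounds (isT : (1 < 2)%N) t0.
  (* Each round lies in the epoch of its leading binary digit, where the crude bound gives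
     positivity. *)
  have -> : t = (2 ^ trunc_log 2 t + (t - 2 ^ trunc_log 2 t))%N by lia.
  apply: lt_le_trans (@exp_pulled_mean_crude _ _ _).
    by rewrite divr_gt0 // mulr_gt0 // exprn_gt0 ?ltr0n ?expn_gt0.
  by move: h2; rewrite expnS; lia.
set S := \sum_(1 <= t < T.+1) log_loss t.
have -> : \prod_(1 <= t < T.+1) x t = expR (T%:R * ln mu - S).
  have -> : T%:R * ln mu = \sum_(1 <= t < T.+1) ln mu :> R.
    by rewrite sumr_const_nat subn1 mulr_natl.
  rewrite -sumrB expR_sum; apply: eq_big_nat => t /andP[t1 _].
  by rewrite /log_loss opprB addrCA subrr addr0 lnK ?posrE ?x0.
rewrite -expRM [(_ - S) * _]mulrC mulrBr mulKf ?gt_eqF // expRD lnK ?posrE //.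
have := expR_ge1Dx (- (T%:R^-1 * S)).
move=> /(ler_wpM2l (ltW mu_gt0)); lra.
Qed.

End anytime.

(** * Choice of constants and conclusion *)

Theorem theorem3 (R : realType) :
  exists C : R, 0 < C /\
  forall k : nat, (0 < k)%N ->
  exists T0 : nat,
  forall (nu : 'I_k -> probability (measurableTypeR R) R),
    (forall i, nu i `[0%R, 1%R] = 1%E) ->
  forall (i0 : 'I_k) (T : nat), (T0 <= T)%N ->
    nash_regret nu i0 T <=
      C * Num.sqrt (k%:R * ln T%:R / T%:R) * ln T%:R.
Proof.
(* Three times the constant of [HB], the factor 3 coming from the number of epochs. *)
exists (75 * 1000); split; first by rewrite mulr_gt0 ?ltr0n.
move=> k k0; exists ((64 * k) ^ 4)%N => nu nu01 i0 T hT.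
have kT64 : (64 * k <= T)%N.
  by apply: leq_trans hT; rewrite -{1}[(64 * k)%N]expn1 leq_pexp2l // muln_gt0.
have T1 : 1 <= T%:R :> R by rewrite ler1n; lia.
have T0 : 0 < T%:R :> R by lra.
have l0 : 0 <= ln T%:R :> R by exact: ln_ge0.
have k1 : 1 <= k%:R :> R by rewrite ler1n.
rewrite /nash_regret; set RHS := (X in _ <= X).
have RHS0 : 0 <= RHS by rewrite !mulr_ge0 ?ler0n ?sqrtr_ge0.
(* Without a positive mean the regret is nonpositive; otherwise division by the largest mean is
   legitimate. *)
have [m0|m0] := leP (mu_star nu) 0.
  by apply: le_trans RHS0; rewrite subr_le0 (le_trans m0) // powR_ge0.
(* Means are nonnegative, so the default value 0 of the maximum does not prevent an arm from
   attaining it. *)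
have [star _ Estar] : {i | i \in xpredT & mu_star nu = arm_mean nu i}.
  by apply: (@eq_bigmax _ _ _ _ i0) => // i _; case/andP: (mean_itv nu01 i).
have mean_le i : arm_mean nu i <= arm_mean nu star.
  by rewrite -Estar; exact: le_bigmax.
rewrite Estar in m0 *; set mu := arm_mean nu star in m0 mean_le *.
have mu1 : mu <= 1 by case/andP: (mean_itv nu01 star).
have := prod_exp_pulled_mean nu01 i0 m0 (T := T); rewrite -(ltr0n R) => /(_ T0).
have hk : (k <= T)%N by lia.
have h4 : (4 <= T)%N by lia.
have := sum_log_loss nu01 i0 mean_le m0 h4 hk.
set P := powR _ _; set S := \sum_(_ <= _ < _) _ => HS HP.
have l1 : 1 <= ln T%:R :> R.
  apply: (@le_trans _ _ (ln (2 ^ 2)%:R)); last exact: le_ln_nat.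
  by rewrite ln_pow2; have := ln2_ge_half R; lra.
set l := ln T%:R in l0 l1 HS RHS RHS0 *.
set Q := Num.sqrt (k%:R * T%:R * l).
have Q0 : 0 <= Q by exact: sqrtr_ge0.
have ERHS : RHS = (75 * 1000) * Q * l / T%:R.
  rewrite /RHS; have -> : k%:R * l / T%:R = k%:R * T%:R * l / T%:R ^+ 2.
    by field; rewrite gt_eqF.
  rewrite sqrtrM ?mulr_ge0 ?ler0n // sqrtrV ?sqr_ge0 // sqrtr_sqr gtr0_norm // -/Q.
  by field; rewrite gt_eqF.
(* After squaring this is k l^3 <= T, which determines the choice of [T0]. *)
have kl2 : k%:R * l ^+ 2 <= Q.
  rewrite -(@ler_pXn2r _ 2) ?nnegrE // ?mulr_ge0 ?sqr_ge0 ?ler0n //.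
  rewrite sqr_sqrtr ?mulr_ge0 ?ler0n //.
  have -> : (k%:R * l ^+ 2) ^+ 2 = k%:R * l ^+ 3 * (k%:R * l) by ring.
  have -> : k%:R * T%:R * l = T%:R * (k%:R * l) by ring.
  by rewrite ler_wpM2r ?mulr_ge0 ?ler0n // ln_cube_le.
(* The factor [mu] cancels the divisions by the largest mean. Since k and l are at least 1, the
   lower-order part is at most 64 k l^2, and 64 + 24000 + 216 < 25000. *)
have HB : mu * epoch_bound nu star T <= (25 * 1000) * Q.
  rewrite /epoch_bound -/mu -/l -/Q.
  have -> : mu * ((k%:R + 11 + 8000 * k%:R * l / mu) * (3 * l) + 28 + 216 * Q / mu) =
    mu * ((k%:R + 11) * (3 * l) + 28) + (24 * 1000) * (k%:R * l ^+ 2) + 216 * Q.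
    by field; rewrite gt_eqF.
  have : mu * ((k%:R + 11) * (3 * l) + 28) <= (k%:R + 11) * (3 * l) + 28.
    by rewrite ler_piMl // addr_ge0 ?ler0n // mulr_ge0 ?mulr_ge0 ?ler0n // addr_ge0 ?ler0n.
  have kl : k%:R * l <= k%:R * l ^+ 2.
    by rewrite ler_wpM2l ?ler0n // expr2 ler_peMl.
  have l_kl : l <= k%:R * l by rewrite ler_peMl.
  by lra.
have : mu / T%:R * S <= RHS.
  rewrite ERHS mulrAC ler_wpM2r ?invr_ge0 ?(ltW T0) //.
  apply: le_trans (ler_wpM2l (ltW m0) HS) _.
  have -> : mu * (3 * l * epoch_bound nu star T) = 3 * l * (mu * epoch_bound nu star T) by ring.
  apply: le_trans (ler_wpM2l _ HB) _; first by rewrite mulr_ge0 ?ler0n.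
  by lra.
by move=> H; rewrite lerBlDl -(subrK (mu / T%:R * S) mu) lerD.
Qed.
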